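(* If a symmetric nc polynomial $p\in\mathbb{R}\langle x,x^T\rangle$ is nc plurisubharmonic on an nc open set, then $p$ is, in fact, nc plurisubharmonic everywhere and has the form $$p=\sum_j f_j^T f_j+\sum_j k_j k_j^T+F+F^T,$$ where the sums are finite and each $f_j$, $k_j$ and $F$ is an nc analytic polynomial.
   Context: Let $x=(x_1,\dots,x_g)$, $x^T=(x_1^T,\dots,x_g^T)$ be $2g$ noncommuting formal variables and $\mathbb{R}\langle x,x^T\rangle$ the free algebra of nc (noncommutative) polynomials in them, with the involution $^T$ that reverses products and exchanges $x_j$ and $x_j^T$. Let $h=(h_1,\dots,h_g)$, $h^T=(h_1^T,\dots,h_g^T)$ be $2g$ further noncommuting variables, with the involution extended in the same way. An nc polynomial $p$ is symmetric if $p^T=p$, and nc analytic if it contains only the variables $x_j$ and none of the $x_j^T$. For $X\in(\mathbb{R}^{n\times n})^g$, $p(X,X^T)$ is obtained by replacing $x_j$ by $X_j$ and $x_j^T$ by the matrix transpose $X_j^T$. The nc complex hessian of $p$ is the nc polynomial in $x,x^T,h,h^T$ $$q(x,x^T)[h,h^T]:=\frac{\partial^2 p}{\partial s\,\partial t}(x+th,\,y+sk)\Big|_{t=s=0}\Big|_{y=x^T,\,k=h^T},$$ where first every $x_i^T$ in $p$ is replaced by a formal variable $y_i$. A nonempty set $\mathcal{G}\subseteq\bigcup_{n\ge1}(\mathbb{R}^{n\times n})^g$, with $\mathcal{G}_n:=\mathcal{G}\cap(\mathbb{R}^{n\times n})^g$, is an nc open set if (i) it respects direct sums: for every finite list $X^1\in\mathcal{G}_{n_1},\dots,X^t\in\mathcal{G}_{n_t}$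 (repetitions allowed) the componentwise block-diagonal direct sum $\bigoplus_j X^j$ lies in $\mathcal{G}_{n_1+\cdots+n_t}$; and (ii) there is a positive integer $n_0$ such that $\mathcal{G}_n$ is open for all $n>n_0$. A symmetric $p$ is nc plurisubharmonic on $\mathcal{G}$ if $q(X,X^T)[H,H^T]\succeq0$ for all $n\ge1$, all $X\in\mathcal{G}_n$ and all $H\in(\mathbb{R}^{n\times n})^g$. It is nc plurisubharmonic everywhere if $q(X,X^T)[H,H^T]\succeq0$ for all $n\ge1$ and all $X,H\in(\mathbb{R}^{n\times n})^g$. *)

(* Defs.v *)
From HB Require Import structures.
From mathcomp Require Import all_boot all_order all_algebra finmap.
From mathcomp Require Import all_classical all_reals topology normedtype.
(* The notations of monalg clash with those of mathcomp-analysis. *)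
From mathcomp Require Import -(notations) monalg.

Set Implicit Arguments.
Unset Strict Implicit.
Unset Printing Implicit Defensive.

Import Order.TTheory GRing.Theory Num.Theory numFieldNormedType.Exports.

Local Open Scope classical_set_scope.
Local Open Scope ring_scope.

(* The free algebra R<L>: the monoid algebra of the free monoid on L. *)
Notation freealg R L := (malg (fmonom L) R).

Definition ncmon (R : realType) (L : choiceType) (c : R) (w : seq L) :
  freealg R L := mkmalgU (FMonom w) c.

Definition ncvar (R : realType) (L : choiceType) (l : L) : freealg R L :=
  ncmon 1 [:: l].

(* Evaluation of a noncommutative polynomial in a ring S (given with a map f
   from the scalars to S): each letter l is replaced by phi l. *)
Definition nceval (R : realType) (L : choiceType) (S : pzRingType)
    (f : R -> S) (phi : L -> S) (p : freealg R L) : S :=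
  \sum_(w <- msupp p) f (mcoeff w p) * \prod_(l <- fmonom_val w) phi l.

(* inl j is the letter x_j and inr j is the letter x_j^T. *)
Definition xletter (g : nat) : choiceType := ('I_g + 'I_g)%type.

Notation ncpoly R g := (freealg R (xletter g)).

Definition trletter (g : nat) (l : xletter g) : xletter g :=
  match l with inl j => inr j | inr j => inl j end.

Definition ncadj (R : realType) (g : nat) (p : ncpoly R g) : ncpoly R g :=
  \sum_(w <- msupp p)
     ncmon (mcoeff w p) (rev (map (@trletter g) (fmonom_val w))).

Definition ncsymmetric (R : realType) (g : nat) (p : ncpoly R g) : Prop :=
  ncadj p = p.

Definition ncanalytic (R : realType) (g : nat) (p : ncpoly R g) : Prop :=
  forall (w : fmonom (xletter g)) (j : 'I_g),
    w \in msupp p -> inr j \notin fmonom_val w.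

(* The letters of R<x, x^T, h, h^T>: inl l for x and x^T, inr l for h and h^T. *)
Definition xhletter (g : nat) : choiceType := (xletter g + xletter g)%type.

Notation xhpoly R g := (freealg R (xhletter g)).

(* p(x + t h, y + s k) in (R<x, y, h, k>[s])[t], s and t being central: the
   outer 'X is t and the inner one is s. The involution plays no role in the
   differentiation and all letters are free, so the letters x_j^T and h_j^T
   themselves serve as the formal variables y_j and k_j. *)
Definition hess_shift (R : realType) (g : nat) (p : ncpoly R g) :
    {poly {poly xhpoly R g}} :=
  nceval (fun c : R => (c%:A : xhpoly R g)%:P%:P)
    (fun l : xletter g =>
       let a : xhpoly R g := ncvar R (inl l : xhletter g) in
       let b : xhpoly R g := ncvar R (inr l : xhletter g) in
       match l with
       | inl _ => a%:P%:P + 'X * b%:P%:P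
       | inr _ => a%:P%:P + ('X)%:P * b%:P%:P
       end) p.

(* The derivative in t (outer), then in s (inner), then t = s = 0. *)
Definition nchessian (R : realType) (g : nat) (p : ncpoly R g) : xhpoly R g :=
  (map_poly (fun r : {poly xhpoly R g} => r^`()) (hess_shift p)^`()).[0].[0].

Definition xval (R : realType) (g n : nat) (X : 'I_g -> 'M[R]_n)
    (l : xletter g) : 'M[R]_n :=
  match l with inl j => X j | inr j => (X j)^T end.

(* q(X, X^T)[H, H^T] *)
Definition xheval (R : realType) (g n : nat) (q : xhpoly R g)
    (X H : 'I_g -> 'M[R]_n) : 'M[R]_n :=
  nceval (fun c : R => c%:M)
    (fun l : xhletter g => match l with inl a => xval X a | inr a => xval H a end)
    q.

Definition psdmx (R : realType) (n : nat) (M : 'M[R]_n) : Prop :=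
  M^T = M /\ forall v : 'cV[R]_n, 0 <= (v^T *m M *m v) ord0 ord0.

(* A graded set of g-tuples of matrices; the component G 0 (matrices of size
   0) is never looked at. *)
Definition ncset (R : realType) (g : nat) :=
  forall n : nat, set ('I_g -> 'M[R]_n).

Definition respects_direct_sums (R : realType) (g : nat) (G : ncset R g) :
    Prop :=
  forall (t : nat) (n : 'I_t -> nat) (X : forall i : 'I_t, 'I_g -> 'M[R]_(n i)),
    (0 < t)%N -> (forall i, (0 < n i)%N) -> (forall i, G (n i) (X i)) ->
    G (\sum_i n i)%N (fun j : 'I_g => \mxdiag_i X i j).

Definition ncopen (R : realType) (g : nat) (G : ncset R g) : Prop :=
  [/\ exists2 n : nat, (0 < n)%N & G n !=set0,
      respects_direct_sums G &
      exists2 n0 : nat, (0 < n0)%N & forall n : nat, (n0 < n)%N ->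
        open (G n : set {ptws 'I_g -> 'M[R]_n})].

Definition ncpsh_on (R : realType) (g : nat) (G : ncset R g) (p : ncpoly R g) :
    Prop :=
  forall (n : nat) (X H : 'I_g -> 'M[R]_n),
    (0 < n)%N -> G n X -> psdmx (xheval (nchessian p) X H).

Definition ncpsh_everywhere (R : realType) (g : nat) (p : ncpoly R g) : Prop :=
  forall (n : nat) (X H : 'I_g -> 'M[R]_n),
    (0 < n)%N -> psdmx (xheval (nchessian p) X H).

(* Main.v *)
Require Import Defs.
From mathcomp Require Import all_boot all_order all_algebra finmap.
From mathcomp Require Import all_classical all_reals topology normedtype.
From mathcomp Require Import -(notations) monalg.
From mathcomp Require Import ring.

(* Let q be the complex hessian of p. Evaluating q at X = Y (+) Y in a
   direction H with a single nonzero block K decouples the letters h_j from the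
   letters h_j^T, and leaves the quadratic form
     sum over words w = a t b l m of p of c_w <U(t^T, a^T), b(Y) U(l, m)>,
   where l runs over the letters of one fixed type (say x_j), t over the letters
   of the other type, and U(l, m) := K_l m(Y) v. Some Y in the nc open set and
   some vector v make the vectors m(Y) v independent for all words m of bounded
   length: this holds at one point of a Fock space, hence, by a determinant which
   is polynomial along a line, arbitrarily close to a direct sum of copies of any
   given point. So U is arbitrary.

   Call a word of p bad if it is z l m with z a nonempty word in the letters of
   one type, l a letter of the other type, and m not a word in the letters of
   the type of l. For a bad word with m as long as possible, the diagonal
   entry of the form at (l, m) comes from words m^T l^T b l m, which are bad with
   a longer tail, so that entry is 0; the off-diagonal entry at ((t^T, 1), (l, m)),
   where t is the first letter of z, then vanishes as well, and it contains the
   coefficient of z l m. Hence p has no bad word: its words are analytic,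
   antianalytic, u^T m or u m^T with u and m analytic.

   Finally U(l, m) := phi(l m) - l(Y) phi(m) turns the form into
     sum over u and m of c_(u^T m) <phi(u), phi(m)>,
   so the matrix of the c_(u^T m) is positive semidefinite, and writing it
   as a sum of squares gives the f_j; the other type of letters gives the k_j. *)

Set Implicit Arguments.
Unset Strict Implicit.
Unset Printing Implicit Defensive.

Import Order.TTheory GRing.Theory Num.Theory numFieldNormedType.Exports.

Local Open Scope classical_set_scope.
Local Open Scope ring_scope.

(** * Linear extension of functions of words to nc polynomials *)

Definition nclin (R : realType) (L : choiceType) (V : lmodType R)
    (F : seq L -> V) (p : freealg R L) : V :=
  \sum_(w <- msupp p) mcoeff w p *: F (fmonom_val w).

(** Cancellation can shrink the support of a sum, so additivity is proved by summing over a common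
    finite superset, where the extra coefficients are 0. *)
Lemma nclin_sub (R : realType) (L : choiceType) (V : lmodType R)
    (F : seq L -> V) (p : freealg R L) (d : {fset fmonom L}) :
  (msupp p `<=` d)%fset ->
  nclin F p = \sum_(w <- d) mcoeff w p *: F (fmonom_val w).
Proof.
move=> sub; rewrite /nclin (big_fset_incl _ sub) // => w _ wNp.
by rewrite mcoeff_outdom // scale0r.
Qed.

Lemma nclinD (R : realType) (L : choiceType) (V : lmodType R)
    (F : seq L -> V) (p q : freealg R L) :
  nclin F (p + q) = nclin F p + nclin F q.
Proof.
rewrite (nclin_sub F (msuppD_le p q)) (nclin_sub F (fsubsetUl (msupp p) (msupp q))).
rewrite (nclin_sub F (fsubsetUr (msupp p) (msupp q))) -big_split /=.
by apply: eq_bigr => w _; rewrite mcoeffD scalerDl.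
Qed.

Lemma nclinZ (R : realType) (L : choiceType) (V : lmodType R)
    (F : seq L -> V) (c : R) (p : freealg R L) :
  nclin F (c *: p) = c *: nclin F p.
Proof.
rewrite (nclin_sub F (msuppZ_le c p)) scaler_sumr.
by apply: eq_bigr => w _; rewrite mcoeffZ scalerA.
Qed.

Lemma nclin_sum (R : realType) (L : choiceType) (V : lmodType R)
    (F : seq L -> V) (I : Type) (r : seq I) (p : I -> freealg R L) :
  nclin F (\sum_(i <- r) p i) = \sum_(i <- r) nclin F (p i).
Proof.
apply: (big_morph (nclin F) (nclinD F)).
by rewrite /nclin msupp0 big_seq_fset0.
Qed.

Lemma nclinU (R : realType) (L : choiceType) (V : lmodType R)
    (F : seq L -> V) (c : R) (w : fmonom L) :
  nclin F (mkmalgU w c) = c *: F (fmonom_val w).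
Proof.
by rewrite (nclin_sub F msuppU_le) big_seq_fset1 mcoeffUU.
Qed.

Lemma ncmonE (R : realType) (L : choiceType) (p : freealg R L) :
  p = \sum_(w <- msupp p) ncmon (mcoeff w p) (fmonom_val w).
Proof.
by rewrite {1}(monalgE p); apply: eq_bigr => -[].
Qed.

Lemma ncmonM (R : realType) (L : choiceType) (c1 c2 : R) (w1 w2 : seq L) :
  ncmon c1 w1 * ncmon c2 w2 = ncmon (c1 * c2) (w1 ++ w2).
Proof.
rewrite /ncmon malgM_def fgmulUU; congr (mkmalgU _ _); apply/eqP.
by rewrite fmP fmM.
Qed.

(** * The complex hessian as a mixed derivative of words *)

(** With the type encoded as a boolean, one argument with a parameter [b] serves both types, [~~ b]
    being the other one. *)
Definition ltype (g : nat) (l : xletter g) : bool :=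
  if l is inr _ then true else false.

Definition trword (g : nat) (w : seq (xletter g)) : seq (xletter g) :=
  rev (map (@trletter g) w).

Definition word (S : pzRingType) (L : Type) (phi : L -> S) (w : seq L) : S :=
  \prod_(l <- w) phi l.

Lemma word_cons (S : pzRingType) (L : Type) (phi : L -> S) (l : L) (w : seq L) :
  word phi (l :: w) = phi l * word phi w.
Proof. exact: big_cons. Qed.

Lemma word_cat (S : pzRingType) (L : Type) (phi : L -> S) (u w : seq L) :
  word phi (u ++ w) = word phi u * word phi w.
Proof. exact: big_cat. Qed.

(* The derivative of a word in the letters of type b, at phi and in the
   direction psi; d2word is the mixed derivative in the letters of both types. *)
Fixpoint dword (S : pzRingType) (g : nat) (phi psi : xletter g -> S) (b : bool)
    (w : seq (xletter g)) : S :=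
  if w is l :: w' then
    phi l * dword phi psi b w' + (if ltype l == b then psi l * word phi w' else 0)
  else 0.

Fixpoint d2word (S : pzRingType) (g : nat) (phi psi : xletter g -> S)
    (w : seq (xletter g)) : S :=
  if w is l :: w' then
    phi l * d2word phi psi w' + psi l * dword phi psi (~~ ltype l) w'
  else 0.

(** The four coefficients are followed together: the one of $ts$ in $lw$ needs those of first order
    in $w$, and these need the constant one. *)
Lemma coef_hess_word (S : nzRingType) (g : nat) (phi psi : xletter g -> S)
    (w : seq (xletter g)) :
  let W : {poly {poly S}} := \prod_(l <- w)
    match l with
    | inl _ => (phi l)%:P%:P + 'X * (psi l)%:P%:P
    | inr _ => (phi l)%:P%:P + ('X)%:P * (psi l)%:P%:P
    end in
  [/\ W`_0`_0 = word phi w, W`_1`_0 = dword phi psi false w,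
      W`_0`_1 = dword phi psi true w & W`_1`_1 = d2word phi psi w].
Proof.
rewrite /= /reverse_coercion; elim: w => [|l w].
  have c1 i : (1 : {poly {poly S}})`_i = (i == 0%N)%:R by exact: coef1.
  by rewrite /word !big_nil !c1 /= mulr0n mulr1n coef0 !coef1 coef0.
rewrite big_cons word_cons; set W := \prod_(_ <- w) _;
  move: W => W [IH0 IH1 IH2 IH3].
have coefXM1 (T : nzRingType) (q : {poly T}) : ('X * q)`_1 = q`_0 by rewrite coefXM.
case: l => j /=; rewrite mulrDl -!mulrA !coefD !coefCM !coefXM1 !coefXM /=.
  by rewrite !coefCM !coef0 IH0 IH1 IH2 IH3 !addr0.
by rewrite !coefCM -IH0 -IH1 -IH2 -IH3 !addr0.
Qed.

Lemma nchessianE (R : realType) (g : nat) (p : ncpoly R g) :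
  nchessian p = nclin (d2word (fun l => ncvar R (inl l : xhletter g))
                              (fun l => ncvar R (inr l : xhletter g))) p.
Proof.
rewrite /nchessian horner_coef0 horner_coef0 coef_map_id0 ?deriv0 //.
rewrite !coef_deriv !mulr1n /hess_shift /nceval !coef_sum.
apply: eq_bigr => w _; rewrite !coefCM.
set W := \prod_(_ <- _) _.
have [_ _ _ <-] := coef_hess_word (fun l => ncvar R (inl l : xhletter g))
                              (fun l => ncvar R (inr l : xhletter g)) w.
by rewrite -scalerAl mul1r.
Qed.

Lemma nclin_varM (R : realType) (L : choiceType) (V : lmodType R)
    (F : seq L -> V) (l : L) (p : freealg R L) :
  nclin F (ncvar R l * p) = nclin (fun w => F (l :: w)) p.
Proof.
rewrite {1}(ncmonE p) mulr_sumr nclin_sum; apply: eq_bigr => w _.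
by rewrite ncmonM mul1r nclinU.
Qed.

Lemma nclin_mull (R : realType) (L : choiceType) (n : nat)
    (F : seq L -> 'M[R]_n) (A : 'M[R]_n) (p : freealg R L) :
  nclin (fun w => A * F w) p = A * nclin F p.
Proof.
by rewrite /nclin mulr_sumr; apply: eq_bigr => w _; exact: scalemxAr.
Qed.

(** Evaluation respects left multiplication by a letter, which is the only product in the recursions
    of [word], [dword] and [d2word]. *)
Lemma xheval_nchessian (R : realType) (g n : nat) (p : ncpoly R g)
    (X H : 'I_g -> 'M[R]_n) :
  xheval (nchessian p) X H = nclin (d2word (xval X) (xval H)) p.
Proof.
pose phi (l : xhletter g) := match l with inl a => xval X a | inr a => xval H a end.
have xhevalE q : xheval q X H = nclin (word phi) q.
  rewrite /xheval /nceval /nclin; apply: eq_bigr => w _.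
  by rewrite -[_ * _]/(_ *m _) mul_scalar_mx.
have varM l q : nclin (word phi) (ncvar R l * q) = phi l * nclin (word phi) q.
  by rewrite nclin_varM -nclin_mull; apply: eq_bigr => w _; rewrite word_cons.
have n0 : nclin (word phi) 0 = 0 by rewrite /nclin msupp0 big_seq_fset0.
pose x l := ncvar R (inl l : xhletter g); pose h l := ncvar R (inr l : xhletter g).
have word_x w : nclin (word phi) (word x w) = word (xval X) w.
  elim: w => [|l w IH]; last by rewrite !word_cons varM IH.
  by rewrite /word !big_nil -mpolyC1E nclinU scale1r /word fm1 big_nil.
have dword_x b w :
    nclin (word phi) (dword x h b w) = dword (xval X) (xval H) b w.
  elim: w => [|l w IH] //=; rewrite nclinD varM IH; congr (_ + _).
  by case: ifP => // _; rewrite varM word_x.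
rewrite xhevalE nchessianE [X in nclin _ X]/nclin nclin_sum; apply: eq_bigr => w _.
rewrite nclinZ; congr (_ *: _).
elim: (fmonom_val w) => [|l {}w IH] //=.
by rewrite nclinD !varM IH dword_x.
Qed.

(** * Points of an nc open set where the vectors $w(Y)v$ are independent *)

Lemma trletterK (g : nat) : involutive (@trletter g).
Proof. by case. Qed.

Lemma xval_tr (R : realType) (g n : nat) (X : 'I_g -> 'M[R]_n) (l : xletter g) :
  xval X (trletter l) = (xval X l)^T.
Proof. by case: l => j //=; rewrite trmxK. Qed.

(* rho witnesses that the vectors w(Y) v, for w of length at most d, are
   linearly independent. *)
Definition dual_words (R : realType) (g n d : nat) (Y : 'I_g -> 'M[R]_n)
    (v : 'cV[R]_n) (rho : seq (xletter g) -> 'rV[R]_n) : Prop :=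
  forall b w : seq (xletter g), (size b <= d)%N -> (size w <= d)%N ->
    rho b *m (word (xval Y) w *m v) = (w == b)%:R%:M.

Definition wordtype (g d : nat) : finType := (d.-bseq ('I_g + 'I_g))%type.

(* On the span of the words of length at most d, let X_j be the creation
   operator of x_j plus the annihilation operator of x_j^T; then the transpose
   of X_j creates x_j^T, so that w(X) sends the empty word to the word w plus
   a combination of shorter words. *)
Lemma fock_words (R : realType) (g d N : nat) :
  (#|{: wordtype g d}| <= N)%N ->
  exists (Y : 'I_g -> 'M[R]_N) (v : 'cV[R]_N) rho, dual_words d Y v rho.
Proof.
move=> leN.
(* Index [i] carries the [i]-th word, and the indices in excess carry none, so any large enough [N]
   is allowed. *)
pose wd (i : 'I_N) : option (seq (xletter g)) :=
  omap (fun w : wordtype g d => (w : seq _)) (onth (enum {: wordtype g d}) i).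
have exidx (w : seq (xletter g)) : (size w <= d)%N -> exists i, wd i = Some w.
  move=> wd_le; pose w' : wordtype g d := Bseq wd_le.
  have lt1 : (enum_rank w' < N)%N by apply: leq_trans leN.
  exists (Ordinal lt1); rewrite /wd /= onthE (nth_map w') ?nth_enum_rank //=.
  by rewrite -cardE.
have wd_inj i j w : wd i = Some w -> wd j = Some w -> i = j.
  rewrite /wd.
  case Ei : onth => [u|] //= [<-]; case Ej : onth => [u'|] //= [/val_inj Eu].
  have lti : (i < size (enum {: wordtype g d}))%N by rewrite -onthTE Ei.
  have ltj : (j < size (enum {: wordtype g d}))%N by rewrite -onthTE Ej.
  apply/val_inj/eqP; rewrite -(nth_uniq u lti ltj) ?enum_uniq //.
  by rewrite (@onth_nth _ u _ _ _ Ei) (@onth_nth _ u _ _ _ Ej) Eu.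
(* Entry of the creation operator $w\mapsto lw$; products longer than [d] drop out, as no index
   carries them. *)
pose E l (a b : 'I_N) := if (wd a, wd b) is (Some u, Some w) then u == l :: w
  else false.
pose Y j : 'M[R]_N := \matrix_(a, b) ((E (inl j) a b)%:R + (E (inr j) b a)%:R).
have YE l a b : xval Y l a b = (E l a b)%:R + (E (trletter l) b a)%:R.
  by case: l => j; rewrite /= !mxE // addrC.
have [i0 i0E] := exidx [::] isT.
pose v : 'cV[R]_N := delta_mx i0 0.
pose x w := word (xval Y) w *m v.
(* Coordinates at words shorter than [w] are not controlled; at an index carrying no word the
   coordinate is 0. *)
have xE w : (size w <= d)%N -> forall a, (if wd a is Some u then size w <= size u
  else true)%N ->
    x w a 0 = (wd a == Some w)%:R.
  elim: w => [_ a _|l w IH wd_le a].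
    rewrite /x /word big_nil mul1mx mxE andbT; congr (_%:R).
    by case: (a =P i0) => [->|/eqP aNi0]; rewrite ?i0E ?eqxx //; congr nat_of_bool;
      apply/esym/eqP => aE; case/eqP: aNi0; apply: wd_inj i0E.
  have {}IH := IH (ltnW wd_le).
  rewrite /x word_cons -mulmxA mxE -/(x w).
  have [i iE] := exidx w (ltnW wd_le).
  case aE : (wd a) => [u|]; last first.
    by move=> _; rewrite big1 // => b _; rewrite YE /E aE; case: (wd b) => [?|];
      rewrite addr0 mul0r.
  move=> /= le_wu.
  rewrite (bigD1 i) //= big1 => [|b bNi].
    rewrite addr0 YE /E aE iE IH ?iE // eqxx mulr1.
    rewrite [w == _]negbTE ?addr0 //; apply: contraTneq le_wu => ->.
    by rewrite -leqNgt /= leqnSn.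
  rewrite YE /E aE; case bE: (wd b) => [t|]; last by rewrite addr0 mul0r.
  have tNw : t != w by apply: contraNneq bNi => tw; apply/eqP/(wd_inj _ _ w);
    rewrite ?bE ?tw.
  case: (u =P l :: t) => [ult|_].
    rewrite IH bE; last by move: le_wu; rewrite ult.
    by rewrite [Some _ == _](negbTE tNw) mulr0.
  case: (t =P _) => [tlu|_]; last by rewrite addr0 mul0r.
  rewrite IH bE; last by rewrite tlu /= ltnW // ltnW.
  by rewrite [Some _ == _](negbTE tNw) mulr0.
pose M : 'M[R]_(#|{: wordtype g d}|, N) := \matrix_(i, a) x (enum_val i :
  wordtype g d) a 0.
(* Triangularity: in a linear relation, the coordinate at a longest word with nonzero coefficient
   isolates that coefficient. *)
have : row_free M.
  apply: inj_row_free => c cM0; apply/rowP => i; rewrite mxE.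
  apply/eqP/negP => /negP ci.
  have [k ck kmax] := @arg_maxnP _ i (fun k => c 0 k != 0) (fun k => size
    (enum_val k : wordtype g d)) ci.
  have [a aE] := exidx _ (size_bseq (enum_val k : wordtype g d)).
  have := congr1 (fun A : 'rV_N => A 0 a) cM0.
  rewrite !mxE (bigD1 k) //= big1 ?addr0 => [|k' k'Nk].
    by rewrite mxE xE ?size_bseq ?aE // eqxx mulr1 => /eqP; apply/negP.
  have [->|ck'] := eqVneq (c 0 k') 0; first by rewrite mul0r.
  rewrite mxE xE ?size_bseq ?aE //; last exact: kmax.
  rewrite [_ == _]negbTE ?mulr0 //; apply: contra k'Nk => /eqP[] kk'.
  by apply/eqP/enum_val_inj/val_inj.
case/row_freeP => B MB.
pose P (b : seq (xletter g)) : 'rV[R]_N :=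
  if insub b is Some b' then (col (enum_rank (b' : wordtype g d)) B)^T else 0.
exists Y, v, P => b w b_le w_le; rewrite /P insubT /= -/(x w).
set b' := Sub b b_le : wordtype g d; set w' := Sub w w_le : wordtype g d.
apply/matrixP => i j; rewrite !ord1 {i j} [RHS]mxE mulr1n.
have := congr1 (fun A : 'M_#|{: wordtype g d}| => A (enum_rank w') (enum_rank
  b')) MB.
rewrite !mxE (inj_eq enum_rank_inj) -val_eqE /= => <-.
by apply: eq_bigr => a _; rewrite !mxE enum_rankK mulrC.
Qed.

(** The topology on tuples is the pointwise one, so continuity of each coordinate of the line
    suffices. *)
Lemma line_nbhs (R : realType) (g n : nat) (A : set ('I_g -> 'M[R]_n))
    (Y Z : 'I_g -> 'M[R]_n) :
  open (A : set {ptws 'I_g -> 'M[R]_n}) -> A Y ->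
  \forall t \near (0 : R), A (fun j => Y j + t *: Z j).
Proof.
move=> Aopen AY.
pose phi (t : R) : {ptws 'I_g -> 'M[R]_n} := fun j => Y j + t *: Z j.
have phi0 : phi 0 = Y by apply/funext => j; rewrite /phi scale0r addr0.
have phi_cvg : {ptws, phi @ (0 : R) --> phi 0}.
  apply/cvg_sup => j U [V] [[W] oW <-] WY WU; apply: (filterS WU).
  have /(_ 0) : continuous (fun t : R => Y j + t *: Z j).
    move=> t; apply: cvgD; first exact: cvg_cst.
    exact: scalel_continuous.
  by apply; exact: open_nbhs_nbhs.
apply: phi_cvg; apply: open_nbhs_nbhs; split => //.
by rewrite phi0.
Qed.

Lemma map_word (S T : pzRingType) (f : {rmorphism S -> T}) (L : Type) (n : nat)
    (phi : L -> 'M[S]_n) (w : seq L) :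
  map_mx f (word phi w) = word (fun l => map_mx f (phi l)) w.
Proof.
elim: w => [|l w IH]; first by rewrite /word !big_nil map_mx1.
by rewrite !word_cons -IH map_mxM.
Qed.

Lemma xvalD (R : realType) (g n : nat) (Y Z : 'I_g -> 'M[R]_n) (t : R)
    (l : xletter g) :
  xval (fun j => Y j + t *: Z j) l = xval Y l + t *: xval Z l.
Proof. by case: l => j //=; rewrite linearD linearZ. Qed.

(** Let $P$ have the dual vectors at $t=1$ as rows and $M(t)$ the vectors $w(Y+tZ)v$ as columns.
    Then $D(t)=\det(PM(t))$ is a polynomial with $D(1)=1$, and wherever it is nonzero the rows of
    $(PM(t))^{-1}P$ are dual vectors. *)
Lemma dual_words_line (R : realType) (g n d : nat) (Y Z : 'I_g -> 'M[R]_n)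
    (v : 'cV[R]_n) rho :
  dual_words d (fun j => Y j + 1 *: Z j) v rho ->
  exists2 D : {poly R}, D != 0 & forall t, ~~ root D t ->
    exists rho', dual_words d (fun j => Y j + t *: Z j) v rho'.
Proof.
move=> rho_dual.
pose T := wordtype g d.
pose P : 'M[R]_(#|T|, n) := \matrix_(i, a) rho (enum_val i : T) 0 a.
pose M t : 'M[R]_(n, #|T|) :=
  \matrix_(a, i) (word (xval (fun j => Y j + t *: Z j)) (enum_val i : T) *m v) a 0.
pose phi (l : xletter g) : 'M[{poly R}]_n :=
  map_mx polyC (xval Y l) + 'X *: map_mx polyC (xval Z l).
pose Mp : 'M[{poly R}]_(n, #|T|) :=
  \matrix_(a, i) (word phi (enum_val i : T) *m map_mx polyC v) a 0.
have hornerC k m t (A : 'M[R]_(k, m)) : map_mx (horner_eval t) (map_mx polyC A) = A.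
  by apply/matrixP => i j; rewrite !mxE /horner_eval hornerC.
have MpE t : map_mx (horner_eval t) Mp = M t.
  apply/matrixP => a i; rewrite [RHS]mxE [LHS]mxE [Mp _ _]mxE.
  transitivity (map_mx (horner_eval t) (word phi (enum_val i : T) *m map_mx polyC
    v) a 0).
    by rewrite [RHS]mxE.
  rewrite map_mxM hornerC map_word; congr ((word _ _ *m v) a 0).
  apply/funext => l; rewrite xvalD /phi map_mxD map_mxZ !hornerC.
  by rewrite /= /horner_eval hornerX.
pose D := \det (map_mx polyC P *m Mp).
have DE t : D.[t] = \det (P *m M t).
  by rewrite -[D.[t]]/(horner_eval t D) -det_map_mx map_mxM hornerC MpE.
have PM t (Q : 'rV_n) : Q *m M t = \row_i (Q *m (word (xval (fun j => Y j + t *: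
  Z j)) (enum_val i : T) *m v)) 0 0.
  by apply/rowP => j; rewrite !mxE; apply: eq_bigr => a _; rewrite !mxE.
have D1 : D.[1] = 1.
  rewrite DE; suff -> : P *m M 1 = 1%:M by rewrite det1.
  apply/row_matrixP => i; rewrite row_mul PM //.
  have -> : row i P = rho (enum_val i : T) by apply/rowP => a; rewrite !mxE.
  apply/rowP => j; rewrite mxE rho_dual ?size_bseq // !mxE mulr1n.
  by rewrite (inj_eq val_inj) (inj_eq enum_val_inj) eq_sym.
exists D; first by apply: contra_eq_neq D1 => ->; rewrite horner0 eq_sym oner_eq0.
move=> t; rewrite rootE DE => Dt.
have U : P *m M t \in unitmx by rewrite unitmxE unitfE.
pose rho' (b : seq (xletter g)) : 'rV[R]_n :=
  if insub b is Some b' then row (enum_rank (b' : T)) (invmx (P *m M t) *m P)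
    else 0.
exists rho' => b w b_le w_le; rewrite /rho' insubT /=.
set b' := Sub b b_le : T; set w' := Sub w w_le : T.
apply/matrixP => i j; rewrite !ord1 {i j} [RHS]mxE mulr1n.
have E := congr1 (fun A : 'rV_#|T| => A 0 (enum_rank w')) (PM t (row (enum_rank
  b') (invmx (P *m M t) *m P))).
rewrite [RHS]mxE enum_rankK in E; rewrite -E.
rewrite -row_mul -mulmxA mulVmx // !mxE (inj_eq enum_rank_inj) -val_eqE /=.
by rewrite eq_sym.
Qed.

Lemma near0_nonroot (R : realType) (D : {poly R}) (A : set R) :
  D != 0 -> (\forall t \near (0 : R), A t) -> exists2 t, A t & ~~ root D t.
Proof.
move=> D0 /nbhs_ballP[e /= e0 eA].
(* These [size D] points outnumber the roots of [D]; the shift by 2 keeps them strictly inside the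
   ball of radius [e]. *)
pose s := [seq e / k.+2%:R | k <- iota 0 (size D)].
have s_uniq : uniq s.
  rewrite map_inj_uniq ?iota_uniq // => i j /(mulfI (lt0r_neq0 e0)) /invr_inj /eqP.
  by rewrite eqr_nat => /eqP[].
have : ~~ all (root D) s.
  by apply/negP => sD; have := max_poly_roots D0 sD s_uniq;
    rewrite size_map size_iota ltnn.
case/allPn => t /mapP[k _ ->] tD; exists (e / k.+2%:R) => //.
apply: eA; rewrite /ball /= sub0r normrN ger0_norm ?divr_ge0 ?ltW //.
by rewrite ltr_pdivrMr // ltr_pMr // ltr1n.
Qed.

Lemma ncopen_dual_words (R : realType) (g d : nat) (G : ncset R g) :
  ncopen G -> exists n (Y : 'I_g -> 'M[R]_n) v rho,
    [/\ (0 < n)%N, G n Y & dual_words d Y v rho].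
Proof.
case=> -[n n_gt0 [X GX]] Gsum [n0 n0_gt0 Gopen].
(* With [k] copies the size exceeds both [n0] and the dimension of the Fock space. *)
pose k := (n0 + #|{: wordtype g d}|).+1.
pose N := (\sum_(i < k) n)%N.
have leN : (k <= N)%N by rewrite /N sum_nat_const card_ord leq_pmulr.
pose X' : 'I_g -> 'M[R]_N := fun j => \mxdiag_(i < k) X j.
have GX' : G N X' := Gsum k (fun _ => n) (fun _ => X) isT (fun _ => n_gt0) (fun _
  => GX).
have [|Y [v [rho dualY]]] := @fock_words R g d N.
  by apply: leq_trans leN; rewrite leqW // leq_addl.
(* The line starts at [X'], in the open set, and reaches the Fock point at $t=1$. *)
pose Z j := Y j - X' j.
have dualY' : dual_words d (fun j => X' j + 1 *: Z j) v rho.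
  by congr (dual_words d _ v rho): dualY; apply/funext => j;
    rewrite scale1r addrC subrK.
have [D D0 Dt] := dual_words_line dualY'.
have lt_n0N : (n0 < N)%N by apply: leq_trans leN; rewrite ltnS leq_addr.
have [t GYt /Dt[rho' dualYt]] := near0_nonroot D0 (line_nbhs Z (Gopen N lt_n0N)
  GX').
by exists N, (fun j => X' j + t *: Z j), v, rho'; split => //; apply: leq_trans leN.
Qed.

(** * Transposed words and the quadratic form given by the hessian *)

Lemma trword_cons (g : nat) (l : xletter g) (w : seq (xletter g)) :
  trword (l :: w) = rcons (trword w) (trletter l).
Proof. by rewrite /trword /= rev_cons. Qed.

Lemma trword_cat (g : nat) (u w : seq (xletter g)) :
  trword (u ++ w) = trword w ++ trword u.
Proof. by rewrite /trword map_cat rev_cat. Qed.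

Lemma trwordK (g : nat) : involutive (@trword g).
Proof.
by move=> w; rewrite /trword map_rev revK -map_comp map_id_in // => l _;
  exact: trletterK.
Qed.

Lemma size_trword (g : nat) (w : seq (xletter g)) : size (trword w) = size w.
Proof. by rewrite /trword size_rev size_map. Qed.

Lemma ltype_tr (g : nat) (l : xletter g) : ltype (trletter l) = ~~ ltype l.
Proof. by case: l. Qed.

Lemma word_trword (R : realType) (g n : nat) (X : 'I_g -> 'M[R]_n)
    (w : seq (xletter g)) : word (xval X) (trword w) = (word (xval X) w)^T.
Proof.
elim: w => [|l w IH]; first by rewrite /word !big_nil trmx1.
rewrite trword_cons -cats1 word_cat IH !word_cons {2}/word big_nil mulr1 xval_tr.
by rewrite -[_ * _]/(_ *m _) -trmx_mul.
Qed.

(* The vector (d w)(Y)[K] v, the derivative being in the letters of type b;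
   U l m stands for K_l m(Y) v, which can be prescribed. *)
Fixpoint deriv_vec (R : realType) (g n : nat) (Y : 'I_g -> 'M[R]_n) (b : bool)
    (U : xletter g -> seq (xletter g) -> 'cV[R]_n) (w : seq (xletter g)) :
    'cV[R]_n :=
  if w is l :: w' then
    xval Y l *m deriv_vec Y b U w' + (if ltype l == b then U l w' else 0)
  else 0.

(* v^T q v for the word a^T w, where only the factors with the left derivative
   inside w are kept; a accumulates the transpose of the prefix already read. *)
Fixpoint hess_form (R : realType) (g n : nat) (Y : 'I_g -> 'M[R]_n) (b : bool)
    (U V : xletter g -> seq (xletter g) -> 'cV[R]_n) (a w : seq (xletter g)) : R :=
  if w is l :: w' then
    hess_form Y b U V (trletter l :: a) w' +
    (if ltype l == ~~ b then ((U (trletter l) a)^T *m deriv_vec Y b V w') 0 0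
      else 0)
  else 0.

(** Duality lets a sum of the rank-one matrices $U(b)\rho(b)$ interpolate; this is why the vectors
    $K_l m(Y)v$ can be prescribed. *)
Lemma dual_words_interpolate (R : realType) (g n d : nat) (Y : 'I_g -> 'M[R]_n)
    (v : 'cV[R]_n) rho (U : seq (xletter g) -> 'cV[R]_n) :
  dual_words d Y v rho -> exists K : 'M[R]_n, forall w, (size w <= d)%N ->
    K *m (word (xval Y) w *m v) = U w.
Proof.
move=> dual; exists (\sum_(b : wordtype g d) U b *m rho b) => w w_le.
rewrite mulmx_suml (bigD1 (Sub w w_le : wordtype g d)) //= big1 => [|b bNw].
  by rewrite addr0 -mulmxA dual // eqxx mulmx1.
rewrite -mulmxA dual ?size_bseq //= [w == _]negbTE;
  first by rewrite mulr0n raddf0 mulmx0.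
by apply: contraNneq bNw => wb; apply/eqP/val_inj; rewrite /= -wb.
Qed.

(** On $Y\oplus Y$ the direction sends the second copy to the first for letters of type [b], and
    back for the other letters. Tested on $v$ in the second copy, the hessian keeps only the terms
    whose right derivative is of type [b] and whose left one is of the other type. *)
Lemma ncpsh_hess_form_ge0 (R : realType) (g n d : nat) (p : ncpoly R g)
    (G : ncset R g) (Y : 'I_g -> 'M[R]_n) (v : 'cV[R]_n) rho (b : bool) U :
  respects_direct_sums G -> ncpsh_on G p -> (0 < n)%N -> G n Y ->
  dual_words d Y v rho ->
  (forall w : fmonom (xletter g), w \in msupp p -> (size w <= d)%N) ->
  0 <= \sum_(w <- msupp p) mcoeff w p * hess_form Y b U U [::] (fmonom_val w).
Proof.
move=> Gsum ppsh n_gt0 GY dual p_le.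
have /choice [K KE] : forall l, exists K : 'M[R]_n, forall w, (size w <= d)%N ->
    K *m (word (xval Y) w *m v) = U l w.
  by move=> l; exact: (dual_words_interpolate (U l) dual).
pose N := (\sum_(i < 2) n)%N.
pose X : 'I_g -> 'M[R]_N := fun j => \mxdiag_(i < 2) Y j.
have GX : G N X := Gsum 2%N (fun _ => n) (fun _ => Y) isT (fun _ => n_gt0) (fun _
  => GY).
pose E a : 'M[R]_(N, n) := \mxcol_(i < 2) (i == a)%:R%:M.
have EE a c : (E a)^T *m E c = (a == c)%:R%:M.
  rewrite tr_mxcol mul_mxrow_mxcol (bigD1 a) //= big1 => [|i /negbTE->].
    by rewrite addr0 eqxx trmx1 mul1mx.
  by rewrite mulr0n raddf0 trmx0 mul0mx.
have XE l a : xval X l *m E a = E a *m xval Y l.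
  have -> : xval X l = \mxdiag_(i < 2) xval Y l by case: l => j //=;
    rewrite tr_mxdiag.
  rewrite mul_mxdiag_mxcol mxcol_mul; apply/eq_mxcol => i.
  by rewrite scalar_mxC.
have EX l a : (E a)^T *m xval X l = xval Y l *m (E a)^T.
  by apply: trmx_inj; rewrite !trmx_mul !trmxK -!xval_tr XE.
have wordE w a : word (xval X) w *m E a = E a *m word (xval Y) w.
  elim: w => [|l w IH]; first by rewrite /word !big_nil mul1mx mulmx1.
  by rewrite !word_cons -mulmxA IH !mulmxA XE.
(* For [b] true the blocks are prescribed for the letters $x_j^T$, so $H_j$ is the transpose of the
   prescribed matrix. *)
pose H j : 'M[R]_N := if b then (E ord_max *m (K (inr j))^T *m (E ord0)^T)
                      else (E ord0 *m K (inl j) *m (E ord_max)^T).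
have HE l : xval H l = if ltype l == b then E ord0 *m K l *m (E ord_max)^T
                       else E ord_max *m (K (trletter l))^T *m (E ord0)^T.
  by rewrite /H; case: l => j /=; case: (b) => /=; rewrite ?trmx_mul ?trmxK ?mulmxA.
have [e eE] : {e | e = E ord_max *m v} by exists (E ord_max *m v).
have We w : word (xval X) w *m e = E ord_max *m (word (xval Y) w *m v).
  by rewrite eE mulmxA wordE mulmxA.
have D0 w : dword (xval X) (xval H) (~~ b) w *m e = 0.
  elim: w => [|l w IH] /=; first by rewrite mul0mx.
  rewrite mulmxDl -mulmxA IH mulmx0 add0r; case: ifP => [lb|_];
    last by rewrite mul0mx.
  rewrite -mulmxA We HE ifN; last by rewrite (eqP lb); case: (b).
  by rewrite -!mulmxA (mulmxA (E ord0)^T) EE !mul_scalar_mx scale0r !mulmx0.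
have D1 w : (size w <= d)%N -> dword (xval X) (xval H) b w *m e = E ord0 *m
  deriv_vec Y b U w.
  elim: w => [_|l w IH w_le] /=; first by rewrite mul0mx mulmx0.
  rewrite mulmxDl -mulmxA IH ?(ltnW w_le) // mulmxA XE mulmxDr -!mulmxA;
    congr (_ + _).
  case: ifP => [lb|_]; last by rewrite mul0mx mulmx0.
  rewrite -mulmxA We HE lb -!mulmxA (mulmxA (E ord_max)^T) EE mul1mx KE //.
  exact: ltnW.
have D2 w : forall a, (size a + size w <= d)%N ->
    ((word (xval Y) a *m v)^T *m ((E ord_max)^T *m (d2word (xval X) (xval H) w *m
      e))) 0 0
      = hess_form Y b U U a w.
  elim: w => [a _|l w IH a a_le] /=; first by rewrite mul0mx !mulmx0 mxE.
  rewrite mulmxDl !mulmxDr mxE -IH; last by rewrite addSnnS.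
  congr (_ + _).
    rewrite word_cons -[_ * _]/(_ *m _) !trmx_mul -xval_tr trletterK -!mulmxA.
    by rewrite (mulmxA (E _)^T) EX !mulmxA.
  rewrite -[_ * _]/(_ *m _) -mulmxA HE; case: (ltype l =P b) => [->|/eqP lNb].
    by rewrite ifN ?D0 ?mulmx0 ?mxE //; case: (b).
  have -> : ltype l = ~~ b by move: lNb; case: (ltype l) (b) => [] [].
  rewrite eqxx negbK D1; last first.
    by apply: leq_trans a_le; rewrite -addSnnS leq_addl.
  rewrite -!mulmxA (mulmxA (E ord0)^T) EE mul1mx (mulmxA (E ord_max)^T) EE mul1mx.
  rewrite mulmxA -trmx_mul KE //.
  by apply: leq_trans a_le; rewrite leq_addr.
have N_gt0 : (0 < N)%N by rewrite /N sum_nat_const card_ord muln_gt0.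
have [_ /(_ e)] := ppsh N X H N_gt0 GX.
rewrite xheval_nchessian /nclin mulmx_sumr mulmx_suml summxE.
congr (0 <= _); apply: eq_big_seq => w wp.
rewrite -scalemxAr -scalemxAl mxE -D2; last exact: p_le.
by rewrite /word big_nil mul1mx eE !trmx_mul !mulmxA.
Qed.

(** * Directions supported at a single pair *)

Definition single_dir (R : realType) (g n : nat) (l0 : xletter g) (m0 : seq
  (xletter g))
    (u : 'cV[R]_n) (l : xletter g) (m : seq (xletter g)) : 'cV[R]_n :=
  if (l == l0) && (m == m0) then u else 0.

Lemma cat_neq (T : eqType) (s t : seq T) : s != [::] -> (s ++ t == t) = false.
Proof.
move=> s0; apply/negP => /eqP /(congr1 size); rewrite size_cat => /eqP.
by rewrite -[X in _ == X]add0n eqn_add2r size_eq0 (negbTE s0).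
Qed.

(** The tails of a word have distinct lengths, so the pair [(l0, m0)] is met at one position at most
    and a single term survives. *)
Lemma deriv_vec_single_dir_cat (R : realType) (g n : nat) (Y : 'I_g -> 'M[R]_n)
  (b : bool)
    l0 m0 u w : ltype l0 = b ->
  deriv_vec Y b (single_dir l0 m0 u) (w ++ l0 :: m0) = word (xval Y) w *m u.
Proof.
move=> lb; have deriv_vec0 m : (size m <= size m0)%N -> deriv_vec Y b (single_dir
  l0 m0 u) m = 0.
  elim: m => [|l m IH m_le] //=; rewrite IH ?(ltnW m_le) // mulmx0 add0r
    /single_dir.
  rewrite [m == m0]negbTE ?andbF ?if_same //.
  by apply: contraTneq m_le => ->; rewrite ltnn.
elim: w => [|l w IH] /=.
  by rewrite deriv_vec0 // mulmx0 add0r lb eqxx /single_dir !eqxx /word big_nil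
    mul1mx.
rewrite IH word_cons -mulmxA /single_dir -cat_rcons cat_neq ?andbF ?if_same
  ?addr0 //.
by rewrite -size_eq0 size_rcons.
Qed.

Lemma deriv_vec_single_dir_eq0 (R : realType) (g n : nat) (Y : 'I_g -> 'M[R]_n)
  (b : bool)
    l0 m0 (u : 'cV[R]_n) w : (forall x, w <> x ++ l0 :: m0) ->
  deriv_vec Y b (single_dir l0 m0 u) w = 0.
Proof.
elim: w => [|l w IH] //= wN; rewrite IH ?mulmx0 ?add0r; last first.
  by move=> x wE; apply: (wN (l :: x)); rewrite wE.
rewrite /single_dir; case: (l =P l0) => [ll0|]; last by rewrite if_same.
case: (w =P m0) => [wm0|]; last by rewrite if_same.
by case: (wN [::]); rewrite ll0 wm0.
Qed.

(** The prefixes of a word have distinct lengths too, which forces the left derivative to sit right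
    after [trword m0]. *)
Lemma hess_form_single_dir_cat (R : realType) (g n : nat) (Y : 'I_g -> 'M[R]_n)
  (b : bool)
    l0 m0 u V w : ltype l0 = b ->
  hess_form Y b (single_dir l0 m0 u) V [::] (trword m0 ++ trletter l0 :: w) =
    (u^T *m deriv_vec Y b V w) 0 0.
Proof.
move=> lb.
have hess_form0 a y : (size m0 < size a)%N -> hess_form Y b (single_dir l0 m0 u)
  V a y = 0.
  elim: y a => [|l y IH] a a_gt //=; rewrite IH; last exact: leqW.
  rewrite /single_dir [a == m0]negbTE ?andbF /= ?trmx0 ?mul0mx ?mxE ?if_same
    ?addr0 //.
  by apply: contraTneq a_gt => ->; rewrite ltnn.
suff hess_formE x a : m0 = trword x ++ a ->
    hess_form Y b (single_dir l0 m0 u) V a (x ++ trletter l0 :: w) =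
    (u^T *m deriv_vec Y b V w) 0 0.
  by apply: hess_formE; rewrite trwordK cats0.
elim: x a => [|l x IH] a /= m0E.
  rewrite hess_form0 ?m0E //= add0r ltype_tr lb eqxx trletterK /single_dir.
  by rewrite ?m0E !eqxx.
have am0 : (a == m0) = false by rewrite m0E eq_sym cat_neq // -size_eq0 size_trword.
rewrite IH; last by rewrite m0E trword_cons cat_rcons.
by rewrite /single_dir am0 andbF /= trmx0 mul0mx [(0 : 'M_1) 0 0]mxE if_same addr0.
Qed.

Lemma hess_form_single_dir_eq0 (R : realType) (g n : nat) (Y : 'I_g -> 'M[R]_n)
  (b : bool)
    l0 m0 (u : 'cV[R]_n) V w : (forall x, w <> trword m0 ++ trletter l0 :: x) ->
  hess_form Y b (single_dir l0 m0 u) V [::] w = 0.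
Proof.
move=> wN.
suff hess_formE y a : w = trword a ++ y -> hess_form Y b (single_dir l0 m0 u) V a
  y = 0.
  exact: hess_formE.
elim: y a => [|l y IH] a //= wE; rewrite IH ?add0r; last first.
  by rewrite trword_cons trletterK cat_rcons.
rewrite /single_dir; case: (_ =P l0) => [ll0|];
  last by rewrite /= trmx0 mul0mx mxE if_same.
case: (a =P m0) => [am0|]; last by rewrite /= trmx0 mul0mx mxE if_same.
by case: (wN y); rewrite wE am0 -ll0 trletterK.
Qed.

Lemma deriv_vec_linear (R : realType) (g n : nat) (Y : 'I_g -> 'M[R]_n) (b : bool)
    (U V : xletter g -> seq (xletter g) -> 'cV[R]_n) (c : R) w :
  deriv_vec Y b (fun l a => c *: U l a + V l a) w = c *: deriv_vec Y b U w +
    deriv_vec Y b V w.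
Proof.
elim: w => [|l w IH] /=; first by rewrite scaler0 addr0.
rewrite IH mulmxDr -scalemxAr; case: ifP => _; last by rewrite !addr0.
by rewrite scalerDr addrACA.
Qed.

Lemma hess_form_linearl (R : realType) (g n : nat) (Y : 'I_g -> 'M[R]_n) (b : bool)
    (U1 U2 V : xletter g -> seq (xletter g) -> 'cV[R]_n) (c : R) a w :
  hess_form Y b (fun l a => c *: U1 l a + U2 l a) V a w =
    c * hess_form Y b U1 V a w + hess_form Y b U2 V a w.
Proof.
elim: w a => [|l w IH] a /=; first by rewrite mulr0 addr0.
rewrite IH; case: ifP => _; last by rewrite !addr0.
by rewrite linearD linearZ /= mulmxDl -scalemxAl mxE [X in _ + (X + _)]mxE mulrDr
  addrACA.
Qed.

Lemma hess_form_linearr (R : realType) (g n : nat) (Y : 'I_g -> 'M[R]_n) (b : bool)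
    (U V1 V2 : xletter g -> seq (xletter g) -> 'cV[R]_n) (c : R) a w :
  hess_form Y b U (fun l a => c *: V1 l a + V2 l a) a w =
    c * hess_form Y b U V1 a w + hess_form Y b U V2 a w.
Proof.
elim: w a => [|l w IH] a /=; first by rewrite mulr0 addr0.
rewrite IH; case: ifP => _; last by rewrite !addr0.
by rewrite deriv_vec_linear mulmxDr -scalemxAr mxE [X in _ + (X + _)]mxE mulrDr
  addrACA.
Qed.

(** * Exclusion of the bad words *)

(** Here [z] is the maximal initial run of letters of the type of the first letter, and [l] is the
    letter that ends it. *)
Lemma split_run (g : nat) (y : seq (xletter g)) (b : bool) :
  has (fun l => ltype l == b) y -> has (fun l => ltype l == ~~ b) y ->
  exists b' z l r, [/\ y = z ++ l :: r, z != [::],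
    all (fun l => ltype l == ~~ b') z & ltype l = b'].
Proof.
case: y => // t y hb hNb; exists (~~ ltype t).
pose P := fun l : xletter g => ltype l == ~~ ltype t.
have hP : has P (t :: y).
  by rewrite /P; case: (ltype t) b hb hNb => [] [].
exists (take (find P (t :: y)) (t :: y)), (nth t (t :: y) (find P (t :: y))).
exists (drop (find P (t :: y)).+1 (t :: y)); split.
- by rewrite -drop_nth -?has_find // cat_take_drop.
- by rewrite /= /P ifN //; case: (ltype t).
- rewrite negbK; apply/(all_nthP t) => i; rewrite size_take -has_find hP => lti.
  rewrite nth_take //; have /negbT := before_find t lti.
  by rewrite /P; case: (ltype _) (ltype t) => [] [].
- by apply/eqP; exact: (nth_find t hP).
Qed.

(* No word of s is bad, by induction on d - size m: with U1 and U2 supported at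
   (t^T, 1) and (l, m), the value of the form at e U2 + U1 is affine in e, of
   slope twice the coefficient of z l m. *)
Lemma ncpsh_run (R : realType) (g n d : nat) (s : seq (seq (xletter g)))
    (c : seq (xletter g) -> R) (Y : 'I_g -> 'M[R]_n) (v : 'cV[R]_n) rho :
  uniq s -> (forall w, (c w != 0) = (w \in s)) -> (forall w, c (trword w) = c w) ->
  (forall w, w \in s -> (size w <= d)%N) -> dual_words d Y v rho ->
  (forall b U, 0 <= \sum_(w <- s) c w * hess_form Y b U U [::] w) ->
  forall b z l m, z ++ l :: m \in s -> z != [::] ->
    all (fun l => ltype l == ~~ b) z -> ltype l = b -> all (fun l => ltype l ==
      b) m.
Proof.
move=> s_uniq cE c_tr s_le dual form_ge0 b z l m.
have [k] := ubnP (d - size m); elim: k b z l m => // k IH b z l m.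
rewrite ltnS => le_k zlms z0 zb lb; apply/negPn/negP => m_nb.
have {}m_nb : has (fun l => ltype l == ~~ b) m.
  by move: m_nb; rewrite -has_predC; apply: sub_has => x /=;
    case: (ltype x) (b) => [] [].
case: z => // t z in zlms z0 zb *; case/andP: zb => tb zb {z0}.
have lt_md : (size m < d)%N.
  by have := s_le _ zlms; rewrite size_cat /= addnS; apply: leq_trans;
    rewrite ltnS leq_addl.
(* The prefix $m^Tl^T$ contains both types; splitting it at its first change of type gives a tail
   that contains $lm$, hence is longer than $m$ and again has both types, against the induction
   hypothesis. *)
have c0 x : c (trword m ++ trletter l :: x ++ l :: m) = 0.
  apply/eqP; rewrite -[_ == _]negbK cE; apply/negP => xs.
  have [||b' [z' [l' [r [zE z'0 z'b l'b]]]]] := @split_run g (rcons (trword m)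
    (trletter l)) b.
  - rewrite has_rcons /trword has_rev has_map; apply/orP; right.
    by apply: sub_has m_nb => y /=; rewrite ltype_tr; case: (ltype y) (b) => [] [].
  - by rewrite has_rcons ltype_tr lb eqxx.
  rewrite -cat_rcons zE -catA cat_cons in xs.
  have := IH b' z' l' _ _ xs z'0 z'b l'b.
  move=> /(_ _)/wrap[]; last first.
    rewrite !all_cat /= lb => /and3P[_ _ /andP[/eqP <-]].
    by apply/negP; rewrite -has_predC; apply: sub_has m_nb => y /eqP /= ->;
      case: (b).
  apply: leq_trans le_k; rewrite ltn_sub2l // !size_cat /= addnA addnS ltnS.
  exact: leq_addl.
(* Pairing with [rho z] selects $x=z$ among the words $t\,x\,l\,m$. *)
pose r := (rho z)^T.
pose U1 := single_dir (trletter t) [::] r; pose U2 := single_dir l m v.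
have tb' : ltype (trletter t) = b by rewrite ltype_tr (eqP tb) negbK.
have z_le : (size z <= d)%N.
  apply: leq_trans (s_le _ zlms); rewrite size_cat.
  by apply: leq_trans (leq_addr _ _); exact: leqnSn.
have G1 V y : hess_form Y b U1 V [::] (t :: y) = (r^T *m deriv_vec Y b V y) 0 0.
  by rewrite -[t in t :: y]trletterK; exact: (hess_form_single_dir_cat Y [::] r V
    y tb').
have G12 x : hess_form Y b U1 U2 [::] (t :: x ++ l :: m) = (r^T *m (word (xval Y)
  x *m v)) 0 0.
  by rewrite G1 deriv_vec_single_dir_cat.
have G12N w : (forall x, w <> t :: x ++ l :: m) -> hess_form Y b U1 U2 [::] w = 0.
  move=> wN; have [[y wE]|wN'] := pselect (exists y, w = t :: y); last first.
    by apply: hess_form_single_dir_eq0 => x; rewrite trletterK /= => wE;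
      apply: wN'; exists x.
  rewrite wE G1 deriv_vec_single_dir_eq0 ?mulmx0 ?mxE // => x yE.
  by apply: (wN x); rewrite wE yE.
(* Transposing a word exchanges the two arguments of the form, so the two off-diagonal entries
   agree. *)
have G21 w : hess_form Y b U2 U1 [::] (trword w) = hess_form Y b U1 U2 [::] w.
  have [[x ->]|wN] := pselect (exists x, w = t :: x ++ l :: m).
    rewrite G12 -cat_cons trword_cat !trword_cons cat_rcons
      hess_form_single_dir_cat //.
    rewrite -cats1 deriv_vec_single_dir_cat // word_trword.
    have tr00 (A : 'M[R]_1) : A 0 0 = A^T 0 0 by rewrite mxE.
    by rewrite [RHS]tr00 !trmx_mul trmxK mulmxA.
  rewrite G12N => [|x wE]; last by apply: wN; exists x.
  have [[y wE]|wN'] := pselect (exists y, trword w = trword m ++ trletter l :: y);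
    last first.
    by apply: hess_form_single_dir_eq0 => x wE; apply: wN'; exists x.
  rewrite wE hess_form_single_dir_cat // deriv_vec_single_dir_eq0 ?mulmx0 ?mxE //
    => x yE.
  apply: wN; exists (trword x); rewrite -[w]trwordK wE yE.
  by rewrite trword_cat trwordK trword_cons trword_cat /= !trletterK -cats1 -catA.
pose Q U V := \sum_(w <- s) c w * hess_form Y b U V [::] w.
have Q22 : Q U2 U2 = 0.
  rewrite /Q big1_seq // => w /= _.
  have [[y ->]|wN] := pselect (exists y, w = trword m ++ trletter l :: y);
    last first.
    by rewrite hess_form_single_dir_eq0 ?mulr0 // => x wE; apply: wN; exists x.
  have [[x ->]|yN] := pselect (exists x, y = x ++ l :: m);
    first by rewrite c0 mul0r.
  rewrite hess_form_single_dir_cat // deriv_vec_single_dir_eq0 ?mulmx0 ?mxE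
    ?mulr0 // => x yE.
  by apply: yN; exists x.
have Q21 : Q U2 U1 = Q U1 U2.
  have s_tr : perm_eq s (map (@trword g) s).
    apply: uniq_perm => //; first by rewrite map_inj_uniq //;
      exact: inv_inj (@trwordK g).
    move=> w; rewrite -[w in RHS]trwordK (mem_map (inv_inj (@trwordK g))).
    by apply: etrans (esym (cE w)) _; rewrite -c_tr; exact: cE.
  rewrite /Q (perm_big _ s_tr) big_map; apply: eq_bigr => w _.
  by rewrite c_tr G21.
have Q12 : Q U1 U2 = c (t :: z ++ l :: m).
  rewrite /Q (bigD1_seq (t :: z ++ l :: m) zlms s_uniq) G12 trmxK dual // eqxx
    mxE mulr1n mulr1.
  rewrite big1_seq => [|w /andP[wN ws]]; first exact: addr0.
  have [[x wE]|wN'] := pselect (exists x, w = t :: x ++ l :: m); last first.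
    by rewrite G12N ?mulr0 // => x wE; apply: wN'; exists x.
  rewrite wE G12 trmxK dual //; last first.
    apply: leq_trans (s_le _ ws); rewrite wE /= size_cat.
    by apply: leq_trans (leqnSn _); exact: leq_addr.
  rewrite mxE [x == z]negbTE ?mul0rn ?mulr0 //.
  by apply: contraNneq wN => xz; rewrite wE xz.
have Qge0 e : 0 <= Q U1 U1 + 2%:R * e * c (t :: z ++ l :: m).
  have := form_ge0 b (fun l a => e *: U2 l a + U1 l a).
  rewrite -/(Q _ _); have -> : forall V, Q (fun l a => e *: U2 l a + U1 l a) V =
    e * Q U2 V + Q U1 V.
    move=> V; rewrite /Q mulr_sumr -big_split; apply: eq_bigr => w _ /=.
    by rewrite hess_form_linearl mulrDr mulrCA.
  have QE U : Q U (fun l a => e *: U2 l a + U1 l a) = e * Q U U2 + Q U U1.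
    rewrite /Q mulr_sumr -big_split; apply: eq_bigr => w _ /=.
    by rewrite hess_form_linearr mulrDr mulrCA.
  rewrite !QE Q22 Q21 Q12 mulr0 add0r -[X in _ -> X]/(is_true _).
  by rewrite addrA -mulr2n -[e * _ *+ 2]mulr_natl mulrA addrC.
have cn0 : c (t :: z ++ l :: m) != 0 by rewrite cE.
(* At this [e] the affine function takes the value $-1$. *)
have := Qge0 (- (Q U1 U1 + 1) / (2%:R * c (t :: z ++ l :: m))).
rewrite mulrCA -mulrA mulrAC divff ?mulf_neq0 ?pnatr_eq0 // mulr1.
rewrite opprD addrA subrr add0r oppr_ge0.
by rewrite leNgt ltr01.
Qed.

(** * Words of one type and mixed words *)

Definition homword (g : nat) (b : bool) (w : seq (xletter g)) : bool :=
  all (fun l => ltype l == b) w.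

Definition typed (g : nat) (b : bool) (w : seq (xletter g)) : seq (xletter g) :=
  [seq l <- w | ltype l == b].

(** These are the words $u^Tm$ with $u$ and $m$ nonempty in the letters of type [b]: moving the
    letters of the other type to the front leaves the word unchanged. *)
Definition mixed (g : nat) (b : bool) (w : seq (xletter g)) : bool :=
  [&& w == typed (~~ b) w ++ typed b w, typed (~~ b) w != [::] & typed b w != [::]].

Lemma homword_typed (g : nat) (b : bool) (w : seq (xletter g)) :
  homword b w -> typed b w = w.
Proof. by rewrite /homword => /all_filterP. Qed.

Lemma typed_homword (g : nat) (b : bool) (w : seq (xletter g)) :
  homword b (typed b w).
Proof. exact: filter_all. Qed.

Lemma homword_typedN (g : nat) (b : bool) (w : seq (xletter g)) :
  homword (~~ b) w -> typed b w = [::].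
Proof.
move=> wb; apply/eqP; rewrite -size_eq0 size_filter -leqn0 leqNgt -has_count.
rewrite -all_predC; apply: sub_all wb => l /eqP /= ->.
by case: b.
Qed.

Lemma homword_trword (g : nat) (b : bool) (w : seq (xletter g)) :
  homword b (trword w) = homword (~~ b) w.
Proof.
rewrite /homword /trword all_rev all_map; apply: eq_all => l /=.
by rewrite ltype_tr; case: (ltype l) b => [] [].
Qed.

Lemma mixed_cat (g : nat) (b : bool) (z m : seq (xletter g)) :
  homword (~~ b) z -> homword b m -> z != [::] -> m != [::] -> mixed b (z ++ m).
Proof.
move=> zb mb z0 m0; rewrite /mixed /typed !filter_cat -!/(typed _ _).
rewrite (homword_typed zb) (homword_typedN zb) (homword_typed mb).
by rewrite homword_typedN ?negbK // cats0 eqxx z0 m0.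
Qed.

Lemma mixedN (g : nat) (b : bool) (w : seq (xletter g)) :
  mixed b w -> mixed (~~ b) w = false.
Proof.
case/and3P=> /eqP wE z0 _; apply/negbTE/negP => /and3P[/eqP wE' z0' _].
move: wE' wE z0 z0'; rewrite negbK.
have := typed_homword b w; have := typed_homword (~~ b) w.
case: (typed b w) => // x u; case: (typed (~~ b) w) => // y u'.
move=> /andP[/eqP yb _] /andP[/eqP xb _] -> [xy _].
by move: yb; rewrite -xy xb; case: (b).
Qed.

Lemma homword_mixed (g : nat) (b c : bool) (w : seq (xletter g)) :
  homword c w -> mixed b w = false.
Proof.
move=> wc; apply/negbTE/and3P => -[_ z0 m0].
have [cb|cb] : c = b \/ c = ~~ b by case: (c) (b) => [] []; [left|right|right|left].
  by move: z0; rewrite homword_typedN // negbK -cb.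
by move: m0; rewrite homword_typedN // -cb.
Qed.

(** The negation of being a bad word. *)
Definition runword (g : nat) (w : seq (xletter g)) : Prop :=
  forall b z l m, w = z ++ l :: m -> z != [::] -> homword (~~ b) z ->
    ltype l = b -> homword b m.

Lemma runword_cases (g : nat) (w : seq (xletter g)) : runword w ->
  [\/ homword false w, homword true w, mixed false w | mixed true w].
Proof.
move=> w_run; have [wf|] := boolP (homword false w); first by constructor 1.
have [wt|] := boolP (homword true w); first by constructor 2.
rewrite -!has_predC => hf ht.
have [||b [z [l [r [wE z0 zb lb]]]]] := @split_run g w false.
- by apply: sub_has hf => x /=; case: (ltype x).
- by apply: sub_has ht => x /=; case: (ltype x).
have rb := w_run _ _ _ _ wE z0 zb lb.
have : mixed b w by rewrite wE mixed_cat //= lb eqxx.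
by case: b {zb lb rb}; [constructor 4 | constructor 3].
Qed.

(** * Positivity of the matrix of the coefficients of $u^Tm$ *)

(** The empty word is excluded because $u^Tm$ with an empty factor has letters of one type only and
    belongs to $F$ or $F^T$. *)
Definition goodword (g : nat) (b : bool) (w : seq (xletter g)) : bool :=
  (w != [::]) && homword b w.

(** A mixed word factors as $u^Tm$ in only one way, through its letters of each type, so at most one
    term is nonzero. *)
Lemma sum_mixed (V : nmodType) (g d : nat) (b : bool) (k : seq (xletter g))
    (F : seq (xletter g) -> seq (xletter g) -> V) :
  (size k <= d)%N ->
  \sum_(u : wordtype g d) \sum_(m : wordtype g d)
     (if [&& goodword b u, goodword b m & trword u ++ m == k] then F u m else 0) =
  if mixed b k then F (trword (typed (~~ b) k)) (typed b k) else 0.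
Proof.
move=> k_le.
have typed_le c : (size (typed c k) <= d)%N by rewrite (leq_trans _ k_le) //
  size_filter count_size.
have tr_le : (size (trword (typed (~~ b) k)) <= d)%N by rewrite size_trword.
have condE (u m : seq (xletter g)) :
    [&& goodword b u, goodword b m & trword u ++ m == k] =
    [&& mixed b k, u == trword (typed (~~ b) k) & m == typed b k].
  apply/and3P/and3P => [[/andP[u0 ub] /andP[m0 mb] /eqP <-]|[kb /eqP-> /eqP->]].
    have tub : homword (~~ b) (trword u) by rewrite homword_trword negbK.
    split; first by rewrite mixed_cat // -size_eq0 size_trword size_eq0.
      rewrite /typed filter_cat -!/(typed _ _) (homword_typed tub).
      by rewrite homword_typedN ?negbK // cats0 trwordK.
    by rewrite /typed filter_cat -!/(typed _ _) (homword_typedN tub) homword_typed.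
  case/and3P: kb => [kE z0 m0]; split; last by rewrite trwordK eq_sym.
    by rewrite /goodword -size_eq0 size_trword size_eq0 z0 homword_trword
      typed_homword.
  by rewrite /goodword m0 typed_homword.
rewrite (bigD1 (Sub (trword (typed (~~ b) k)) tr_le)) //= addrC big1 => [|u uN].
  rewrite add0r (bigD1 (Sub (typed b k) (typed_le b))) //= addrC big1 => [|m mN].
    by rewrite add0r condE !eqxx !andbT.
  by rewrite condE [m == _ :> seq _]negbTE ?andbF //.
by rewrite big1 // => m _; rewrite condE [u == _ :> seq _]negbTE ?andbF //.
Qed.

(* The choice U(l, m) = f(l m) - l(Y) f(m) telescopes. *)
Lemma deriv_vec_potential (R : realType) (g n : nat) (Y : 'I_g -> 'M[R]_n) (b :
  bool)
    (f : seq (xletter g) -> 'cV[R]_n) w : f [::] = 0 -> homword b w ->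
  deriv_vec Y b (fun l a => f (l :: a) - xval Y l *m f a) w = f w.
Proof.
move=> f0; elim: w => [|l w IH] //= /andP[-> wb].
by rewrite IH // addrC subrK.
Qed.

Lemma deriv_vec_homword (R : realType) (g n : nat) (Y : 'I_g -> 'M[R]_n) (b : bool)
    (U : xletter g -> seq (xletter g) -> 'cV[R]_n) w :
  homword (~~ b) w -> deriv_vec Y b U w = 0.
Proof.
elim: w => [|l w IH] //= /andP[/eqP-> wb].
by rewrite IH // mulmx0 add0r; case: (b).
Qed.

Lemma deriv_vec_homword_cat (R : realType) (g n : nat) (Y : 'I_g -> 'M[R]_n) (b :
  bool)
    (U : xletter g -> seq (xletter g) -> 'cV[R]_n) z m :
  homword (~~ b) z -> deriv_vec Y b U (z ++ m) = word (xval Y) z *m deriv_vec Y b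
    U m.
Proof.
elim: z => [_|l z IH /= /andP[/eqP lb zb]]; first by rewrite /word big_nil mul1mx.
by rewrite IH // lb word_cons -mulmxA; case: (b); rewrite addr0.
Qed.

(** The form needs a letter of type [~~ b] to the left of one of type [b], and here there is
    none. *)
Lemma hess_form_homword_cat (R : realType) (g n : nat) (Y : 'I_g -> 'M[R]_n) (b :
  bool)
    (U V : xletter g -> seq (xletter g) -> 'cV[R]_n) a z m :
  homword b z -> homword (~~ b) m -> hess_form Y b U V a (z ++ m) = 0.
Proof.
move=> zb mb; elim: z a zb => [a _|l z IH a /andP[/eqP lb zb]] /=; last first.
  by rewrite IH // lb add0r; case: (b).
elim: m a mb => [|l m IH a /andP[_ mb]] //=; rewrite IH // add0r.
by rewrite deriv_vec_homword // mulmx0 mxE if_same.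
Qed.

Lemma hess_form_mixed (R : realType) (g n : nat) (Y : 'I_g -> 'M[R]_n) (b : bool)
    (U V : xletter g -> seq (xletter g) -> 'cV[R]_n) z m :
  homword (~~ b) z -> homword b m ->
  hess_form Y b U V [::] (z ++ m) = ((deriv_vec Y b U (trword z))^T *m deriv_vec
    Y b V m) 0 0.
Proof.
move=> zb mb.
(* The derivatives falling on the prefix [a], already read, have to be subtracted. *)
suff hess_formE a : homword b a -> hess_form Y b U V a (z ++ m) =
    ((deriv_vec Y b U (trword z ++ a) - word (xval Y) (trword z) *m deriv_vec Y b
      U a)^T
      *m deriv_vec Y b V m) 0 0.
  by rewrite hess_formE // cats0 mulmx0 subr0.
elim: z a zb => [a _ ab|l z IH a /andP[/eqP lb zb] ab] /=.
  rewrite /word big_nil mul1mx subrr trmx0 mul0mx mxE.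
  by rewrite -[m]cats0 hess_form_homword_cat.
have tlb : ltype (trletter l) = b by rewrite ltype_tr lb negbK.
rewrite IH //=; last by rewrite tlb eqxx.
rewrite tlb lb !eqxx (deriv_vec_homword_cat _ _ _ zb) trword_cons cat_rcons
  -cats1 word_cat.
rewrite word_cons [word _ [::]]big_nil mulr1 -[_ * _]/(_ *m _).
have -> : word (xval Y) z = (word (xval Y) (trword z))^T by rewrite word_trword
  trmxK.
rewrite [in X in _ + X]mulmxA -trmx_mul -mulmxA.
set P := deriv_vec _ _ _ _; set W := word _ _; set q := deriv_vec _ _ V m.
have mxD (A B : 'M[R]_1) : A 0 0 + B 0 0 = (A + B) 0 0 by rewrite mxE.
by rewrite mxD -mulmxDl -linearD /= mulmxDr opprD addrA subrK.
Qed.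

(** The potential is $f(w)=x(w)e$ for one unit vector $e$, with $f(1)=0$; the form then becomes the
    scalar quadratic form of the coefficients at $x$. *)
Lemma ncpsh_gram_ge0 (R : realType) (g n d : nat) (s : seq (seq (xletter g)))
    (c : seq (xletter g) -> R) (Y : 'I_g -> 'M[R]_n) (b : bool)
    (x : seq (xletter g) -> R) :
  uniq s -> (forall w, (c w != 0) = (w \in s)) ->
  (forall w, w \in s -> (size w <= d)%N) -> (forall w, w \in s -> runword w) ->
  (0 < n)%N -> (forall U, 0 <= \sum_(w <- s) c w * hess_form Y b U U [::] w) ->
  0 <= \sum_(u : wordtype g d) \sum_(m : wordtype g d)
    (if goodword b u && goodword b m then c (trword u ++ m) * (x u * x m) else 0).
Proof.
move=> s_uniq cE s_le s_run n_gt0 form_ge0.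
pose e : 'cV[R]_n := delta_mx (Ordinal n_gt0) 0.
pose f (w : seq (xletter g)) : 'cV[R]_n := if w == [::] then 0 else x w *: e.
have ffE (u m : seq (xletter g)) : u != [::] -> m != [::] ->
    ((f u)^T *m f m) 0 0 = x u * x m.
  move=> /negbTE u0 /negbTE m0; rewrite /f u0 m0 [(_ *: _)^T]linearZ /=
    -scalemxAl -scalemxAr.
  by rewrite /e trmx_delta mul_delta_mx !mxE eqxx mulr1.
pose U l a := f (l :: a) - xval Y l *m f a.
have UE w : homword b w -> deriv_vec Y b U w = f w by apply: deriv_vec_potential.
have hess_formE w : w \in s -> hess_form Y b U U [::] w =
    \sum_(u : wordtype g d) \sum_(m : wordtype g d)
      (if [&& goodword b u, goodword b m & trword u ++ m == w] then x u * x m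
        else 0).
  move=> ws; rewrite (sum_mixed b (fun u m => x u * x m) (s_le w ws)).
  (* Every word of [s] that is not mixed for [b] splits in this way, possibly with an empty factor,
     and contributes 0. *)
  have hess_form0 y z : homword b y -> homword (~~ b) z -> w = y ++ z -> ~~ mixed
    b w ->
      hess_form Y b U U [::] w = if mixed b w then x (trword (typed (~~ b) w)) *
        x (typed b w) else 0.
    by move=> yb zb wE /negbTE->; rewrite wE hess_form_homword_cat.
  have [wb|wNb] := boolP (mixed b w).
    case/and3P: (wb) => /eqP wE z0 m0.
    rewrite [in LHS]wE hess_form_mixed ?typed_homword // !UE ?typed_homword //;
      last first.
      by rewrite homword_trword typed_homword.
    by rewrite ffE // -size_eq0 size_trword size_eq0.
  have [|[]] : homword b w \/ homword (~~ b) w \/ mixed (~~ b) w.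
    have := runword_cases (s_run w ws); move: wNb.
    by case: (b) => wNb [] H;
      first [by left | by right; left | by right; right | by rewrite H in wNb].
  - by move=> wb; have := hess_form0 w [::] wb isT;
    rewrite cats0 (negbTE wNb) => ->.
  - by move=> wb; have := hess_form0 [::] w isT wb; rewrite (negbTE wNb) => ->.
  case/and3P => /eqP wE _ _; rewrite negbK in wE.
  have := hess_form0 _ _ (typed_homword b w) (typed_homword (~~ b) w) wE wNb.
  by rewrite (negbTE wNb).
have := form_ge0 U; congr (0 <= _).
under eq_big_seq => w ws do rewrite hess_formE // mulr_sumr.
rewrite exchange_big /=; apply: eq_bigr => u _.
under eq_bigr do rewrite mulr_sumr.
rewrite exchange_big /=; apply: eq_bigr => m _.
case: (goodword b u) => /=; last by rewrite big1 // => w _; rewrite mulr0.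
case: (goodword b m) => /=; last by rewrite big1 // => w _; rewrite mulr0.
have [ws|wNs] := boolP (trword u ++ m \in s).
  rewrite (bigD1_seq _ ws s_uniq) /= eqxx big1 ?addr0 // => w /negbTE wN.
  by rewrite eq_sym wN mulr0.
have /eqP-> : c (trword u ++ m) == 0 by rewrite -[_ == _]negbK cE.
rewrite mul0r big1_seq // => w /= ws; case: eqP => [wE|]; last by rewrite mulr0.
by rewrite wE ws in wNs.
Qed.

(** * From a positive semidefinite matrix to a sum of squares *)

(** Symmetric elimination: subtracting $a^Ta$, with $a$ a nonzero row over the square root of its
    diagonal entry, kills that row, keeps zero rows zero and preserves positivity. *)
Lemma psdmx_gram (R : realType) (n : nat) (C : 'M[R]_n) : psdmx C ->
  exists A : seq 'rV[R]_n, C = \sum_(a <- A) a^T *m a.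
Proof.
have [k] := ubnP #|[pred i | row i C != 0]|; elim: k C => // k IH C.
rewrite ltnS => C_le [C_sym C_ge0].
have [/pred0P C0|/pred0Pn[i /= Ci0]] := boolP (pred0b [pred i | row i C != 0]).
  exists [::]; rewrite big_nil; apply/row_matrixP => i; rewrite row0.
  by have /negbFE/eqP := C0 i.
have formE (v : 'cV[R]_n) (t : R) :
    ((v + t *: delta_mx i 0)^T *m C *m (v + t *: delta_mx i 0)) 0 0 =
    (v^T *m C *m v) 0 0 + 2%:R * t * (row i C *m v) 0 0 + t ^+ 2 * C i i.
  have rowC : (delta_mx i 0 : 'cV[R]_n)^T *m C = row i C by rewrite rowE trmx_delta.
  have rCe : (row i C *m (delta_mx i 0 : 'cV[R]_n)) 0 0 = C i i by rewrite -colE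
    !mxE.
  have vCe : (v^T *m C *m (delta_mx i 0 : 'cV[R]_n)) 0 0 = (row i C *m v) 0 0.
    have tr00 (A : 'M[R]_1) : A 0 0 = A^T 0 0 by rewrite mxE.
    by rewrite tr00 !trmx_mul trmxK C_sym mulmxA rowC.
  have mxD (A B : 'M[R]_1) : (A + B) 0 0 = A 0 0 + B 0 0 by rewrite mxE.
  have mxZ x (A : 'M[R]_1) : (x *: A) 0 0 = x * A 0 0 by rewrite mxE.
  rewrite [(v + _)^T]linearD /= [(t *: _)^T]linearZ /= !mulmxDl !mulmxDr
    -!scalemxAl.
  rewrite -!scalemxAr rowC !mxD !mxZ vCe rCe; ring.
have Cii_ge0 : 0 <= C i i.
  by have := C_ge0 (0 + 1 *: delta_mx i 0);
    rewrite formE !mulmx0 mxE mulr0 !add0r expr1n mul1r.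
(* If $C_{ii}=0\neq C_{ij}$, the form at $e_j+te_i$ is affine in $t$ with nonzero slope, hence takes
   a negative value. *)
have Cii0 : C i i != 0.
  apply: contraNneq Ci0 => Cii; apply/eqP/rowP => j; rewrite [RHS]mxE.
  apply/eqP/negP => /negP Cij0; rewrite mxE in Cij0.
  pose Cjj := C j j.
  have Q t : 0 <= Cjj + 2%:R * t * C i j.
    have := C_ge0 (delta_mx j 0 + t *: delta_mx i 0); rewrite formE Cii mulr0 addr0.
    by rewrite trmx_delta -rowE -!colE !mxE.
  have := Q (- (Cjj + 1) / (2%:R * C i j)).
  rewrite mulrCA -mulrA mulrAC divff ?mulf_neq0 ?pnatr_eq0 // mulr1.
  by rewrite opprD addrA subrr add0r oppr_ge0 leNgt ltr01.
pose a : 'rV[R]_n := (Num.sqrt (C i i))^-1 *: row i C.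
have aa : a^T *m a = (C i i)^-1 *: ((row i C)^T *m row i C).
  rewrite /a [(_ *: _)^T]linearZ /= -scalemxAl -scalemxAr scalerA -invfM -expr2
    sqr_sqrtr //.
pose C' := C - a^T *m a.
have rowC' j : row j C' = row j C - ((C i i)^-1 * C i j) *: row i C.
  rewrite /C' aa linearB linearZ /= row_mul; congr (_ - _).
  have -> : row j (row i C)^T = (C i j)%:M by apply/matrixP => x y;
    rewrite !ord1 !mxE mulr1n.
  by rewrite mul_scalar_mx scalerA.
have [||A AE] := IH C'.
- apply: leq_trans C_le; apply: proper_card.
  apply/fintype.properP; split.
    apply/fintype.subsetP => j; rewrite !inE; apply: contraNneq => Cj0.
    have Cij : C i j = 0.
      by rewrite -[C]C_sym mxE; have := congr1 (fun r : 'rV_n => r 0 i) Cj0;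
        rewrite !mxE.
    by rewrite rowC' Cj0 Cij mulr0 scale0r subr0.
  by exists i; rewrite !inE ?Ci0 // negbK rowC' mulVf // scale1r subrr.
- split=> [|v]; first by rewrite /C' linearB /= C_sym trmx_mul trmxK.
  (* This multiple of $e_i$ minimizes the form of [C] along $v+te_i$, and the minimum is the form of
     [C'] at $v$. *)
  have := C_ge0 (v + (- (row i C *m v) 0 0 / C i i) *: delta_mx i 0); rewrite formE.
  have mxD (A B : 'M[R]_1) : (A + B) 0 0 = A 0 0 + B 0 0 by rewrite mxE.
  have mxZ x (A : 'M[R]_1) : (x *: A) 0 0 = x * A 0 0 by rewrite mxE.
  rewrite /C' aa -scaleNr mulmxDr mulmxDl -scalemxAr -scalemxAl mxD mxZ.
  have -> : (v^T *m ((row i C)^T *m row i C) *m v) 0 0 = ((row i C *m v) 0 0) ^+ 2.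
    by rewrite mulmxA -trmx_mul -mulmxA [LHS]mxE big_ord1 mxE expr2.
  by congr (0 <= _); field.
by exists (a :: A); rewrite big_cons -AE /C' addrC subrK.
Qed.

Lemma mcoeff_ncmon (R : realType) (L : choiceType) (c : R) (w k : seq L) :
  mcoeff (FMonom k) (ncmon c w) = if w == k then c else 0.
Proof. by rewrite /ncmon mcoeffU fmP /=; case: eqP. Qed.

Lemma mcoeff_ncadj (R : realType) (g : nat) (p : ncpoly R g) (k : seq (xletter g)) :
  mcoeff (FMonom k) (ncadj p) = mcoeff (FMonom (trword k)) p.
Proof.
rewrite /ncadj raddf_sum /=.
have trE w : (trword w == k) = (w == trword k).
  by apply/eqP/eqP => [<-|->]; rewrite trwordK.
under eq_bigr do rewrite mcoeff_ncmon trE.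
have [kp|kNp] := boolP (FMonom (trword k) \in msupp p).
  rewrite (bigD1_seq _ kp (fset_uniq _)) /= eqxx big1 ?addr0 // => w wN.
  by case: eqP => // wE; case/eqP: wN; case: w wE => w /= ->.
rewrite mcoeff_outdom // big1_seq // => -[w] /= wp; case: eqP => // wE.
by rewrite -wE wp in kNp.
Qed.

Lemma ncadjK (R : realType) (g : nat) : involutive (@ncadj R g).
Proof. by move=> p; apply/malgP => -[k]; rewrite !mcoeff_ncadj trwordK. Qed.

Lemma ncadj_sum (R : realType) (g : nat) (I : Type) (r : seq I) (p : I -> ncpoly
  R g) :
  ncadj (\sum_(i <- r) p i) = \sum_(i <- r) ncadj (p i).
Proof.
apply/malgP => -[k]; rewrite mcoeff_ncadj !raddf_sum /=.
by apply: eq_bigr => i _; rewrite mcoeff_ncadj.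
Qed.

Lemma ncadj0 (R : realType) (g : nat) : ncadj 0 = 0 :> ncpoly R g.
Proof. by rewrite /ncadj msupp0 big_seq_fset0. Qed.

Lemma ncadj_ncmon (R : realType) (g : nat) (c : R) (w : seq (xletter g)) :
  ncadj (ncmon c w) = ncmon c (trword w).
Proof.
apply/malgP => -[k]; rewrite mcoeff_ncadj !mcoeff_ncmon.
by congr (if _ then _ else _); apply/eqP/eqP => [->|<-]; rewrite trwordK.
Qed.

Lemma ncanalyticP (R : realType) (g : nat) (p : ncpoly R g) :
  ncanalytic p <->
  forall w : fmonom (xletter g), w \in msupp p -> homword false (fmonom_val w).
Proof.
split=> [p_an w wp|p_an w j /p_an /allP wf]; last first.
  by apply/negP => /wf.
by apply/allP => -[j|j] //= jw; have := p_an w j wp; rewrite jw.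
Qed.

(** Each row vector of a Gram factorization of the matrix $c(u^Tm)$ is read as the coefficients of
    one [f]. *)
Lemma gram_sos (R : realType) (g d : nat) (b : bool) (p : ncpoly R g)
    (c := fun w => mcoeff (FMonom w) p) :
  (forall w : fmonom (xletter g), w \in msupp p -> (size w <= d)%N) ->
  (forall w, c (trword w) = c w) ->
  (forall x : seq (xletter g) -> R,
    0 <= \sum_(u : wordtype g d) \sum_(m : wordtype g d)
      (if goodword b u && goodword b m then c (trword u ++ m) * (x u * x m) else
        0)) ->
  exists fs : seq (ncpoly R g),
    (forall f, f \in fs -> forall w : fmonom (xletter g),
       w \in msupp f -> homword b (fmonom_val w)) /\
    forall k, mcoeff (FMonom k) (\sum_(f <- fs) ncadj f * f) =
      if mixed b k then c k else 0.
Proof.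
move=> p_le c_tr gram_ge0; pose T := wordtype g d.
pose C : 'M[R]_#|{: T}| := \matrix_(i, j)
  let u : T := enum_val i in let m : T := enum_val j in
  if goodword b u && goodword b m then c (trword u ++ m) else 0.
have [A AE] : exists A : seq 'rV[R]_#|{: T}|, C = \sum_(a <- A) a^T *m a.
  apply: psdmx_gram; split.
    apply/matrixP => i j; rewrite !mxE /= andbC; case: ifP => // _.
    by rewrite -c_tr trword_cat trwordK.
  move=> v; have := gram_ge0 (fun w => if insub w is Some u then v (enum_rank (u
    : T)) 0 else 0).
  congr (0 <= _); rewrite -mulmxA mxE.
  rewrite (reindex (fun i : 'I_#|{: T}| => enum_val i)) /=;
    last exact: (onW_bij _ (enum_val_bij T)).
  apply: eq_bigr => i _; rewrite !mxE mulr_sumr.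
  rewrite (reindex (fun i : 'I_#|{: T}| => enum_val i)) /=;
    last exact: (onW_bij _ (enum_val_bij T)).
  apply: eq_bigr => j _; rewrite !mxE !valK !enum_valK.
  by rewrite /=; case: ifP => _; rewrite ?mul0r ?mulr0 // mulrCA.
pose f (a : 'rV[R]_#|{: T}|) : ncpoly R g :=
  \sum_(u : T) (if goodword b u then ncmon (a 0 (enum_rank u)) u else 0).
exists (map f A); split.
  move=> _ /mapP[a _ ->] -[w]; rewrite -mcoeff_neq0 /=; apply: contraNT => wb.
  rewrite /f raddf_sum big1 // => u _; case: ifP => [/andP[_ ub]|_];
    last by rewrite raddf0.
  rewrite /= mcoeff_ncmon ifN //; apply: contraNneq wb => <-; exact: ub.
move=> k; rewrite big_map.
have ffE a : ncadj (f a) * f a = \sum_(u : T) \sum_(m : T)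
    (if goodword b u && goodword b m then
       ncmon (a 0 (enum_rank u) * a 0 (enum_rank m)) (trword u ++ m) else 0).
  rewrite /f ncadj_sum mulr_suml; apply: eq_bigr => u _.
  rewrite mulr_sumr; apply: eq_bigr => m _.
  case: ifP => _ /=; last by rewrite ncadj0 mul0r.
  by case: ifP => _ /=; rewrite ?mulr0 // ncadj_ncmon ncmonM.
have CE (u m : T) : goodword b u && goodword b m ->
    \sum_(a <- A) a 0 (enum_rank u) * a 0 (enum_rank m) = c (trword u ++ m).
  move=> um; have := congr1 (fun M : 'M_#|{: T}| => M (enum_rank u) (enum_rank
    m)) AE.
  rewrite summxE mxE /= !enum_rankK um => ->; apply: eq_bigr => a _.
  by rewrite mxE big_ord1 mxE.
under eq_bigr do rewrite ffE.
rewrite exchange_big raddf_sum /=.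
transitivity (\sum_(u : T) \sum_(m : T)
    (if [&& goodword b u, goodword b m & trword u ++ m == k] then c k else 0)).
  apply: eq_bigr => u _; rewrite exchange_big raddf_sum /=.
  apply: eq_bigr => m _; rewrite andbA; case: (boolP (goodword b u && goodword b
    m)) => [um|_] /=; last by rewrite big1 ?raddf0.
  rewrite raddf_sum /=; under eq_bigr do rewrite mcoeff_ncmon.
  by case: eqP => [<-|_]; [exact: CE | rewrite big1].
have [k_le|k_gt] := leqP (size k) d.
  by rewrite (sum_mixed b (fun _ _ => c k) k_le).
(* A word longer than [d] is outside the support of [p], so both sides are 0 there. *)
have -> : c k = 0.
  by apply: mcoeff_outdom; apply: contraL k_gt => /p_le; rewrite -leqNgt.
by rewrite if_same big1 // => u _; rewrite big1 // => m _; rewrite if_same.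
Qed.

(** * Positivity of the hessian of a sum of squares *)

Lemma dword_cat (S : pzRingType) (g : nat) (phi psi : xletter g -> S) (b : bool)
  u w :
  dword phi psi b (u ++ w) =
    dword phi psi b u * word phi w + word phi u * dword phi psi b w.
Proof.
elim: u => [|l u IH] /=; first by rewrite mul0r add0r /word big_nil mul1r.
rewrite IH word_cons word_cat mulrDr mulrDl !mulrA.
by case: ifP => _; rewrite ?mul0r ?addr0 // -!mulrA addrAC.
Qed.

Lemma dword_trword (R : realType) (g n : nat) (X H : 'I_g -> 'M[R]_n) (b : bool) w :
  dword (xval X) (xval H) (~~ b) (trword w) = (dword (xval X) (xval H) b w)^T.
Proof.
elim: w => [|l w IH]; first by rewrite /= trmx0.
rewrite trword_cons -cats1 dword_cat IH word_trword /= mulr0 add0r.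
rewrite ltype_tr eqb_negLR negbK word_cons /word big_nil !mulr1 !xval_tr linearD /=.
rewrite -[xval X l * _]/(_ *m _) trmx_mul; congr (_ + _); case: ifP => _.
  by rewrite -[xval H l * _]/(_ *m _) trmx_mul.
by rewrite mulr0 trmx0.
Qed.

Lemma dword_homword (S : pzRingType) (g : nat) (phi psi : xletter g -> S) (b :
  bool) w :
  homword (~~ b) w -> dword phi psi b w = 0.
Proof.
elim: w => [|l w IH] //= /andP[/eqP-> wb].
by rewrite IH // mulr0 add0r; case: (b).
Qed.

Lemma d2word_homword (S : pzRingType) (g : nat) (phi psi : xletter g -> S) (b :
  bool) w :
  homword b w -> d2word phi psi w = 0.
Proof.
elim: w => [|l w IH] //= /andP[/eqP-> wb].
by rewrite IH // dword_homword ?negbK // !mulr0 addr0.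
Qed.

(** Each factor has letters of one type only, so exactly one of the two derivatives falls on it. *)
Lemma d2word_cat (S : pzRingType) (g : nat) (phi psi : xletter g -> S) (b : bool)
  u w :
  homword (~~ b) u -> homword b w ->
  d2word phi psi (u ++ w) = dword phi psi (~~ b) u * dword phi psi b w.
Proof.
move=> ub wb; elim: u ub => [_|l u IH /= /andP[/eqP lb ub]].
  by rewrite /= mul0r (d2word_homword _ _ wb).
rewrite IH // lb negbK eqxx dword_cat (dword_homword _ _ ub) mul0r add0r.
by rewrite mulrDl !mulrA.
Qed.

Lemma psdmxD (R : realType) (n : nat) (A B : 'M[R]_n) :
  psdmx A -> psdmx B -> psdmx (A + B).
Proof.
move=> [A_sym A_ge0] [B_sym B_ge0]; split; first by rewrite linearD /= A_sym B_sym.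
by move=> v; rewrite mulmxDr mulmxDl mxE addr_ge0.
Qed.

Lemma psdmx_sum (R : realType) (n : nat) (I : eqType) (r : seq I) (A : I ->
  'M[R]_n) :
  (forall i, i \in r -> psdmx (A i)) -> psdmx (\sum_(i <- r) A i).
Proof.
move=> A_psd; rewrite big_seq; apply: big_ind => //; last exact: psdmxD.
by split=> [|v]; rewrite ?trmx0 // mulmx0 mul0mx mxE.
Qed.

Lemma psdmx_trmxM (R : realType) (m n : nat) (A : 'M[R]_(m, n)) : psdmx (A^T *m A).
Proof.
split=> [|v]; first by rewrite trmx_mul trmxK.
rewrite mulmxA -mulmxA -trmx_mul mxE sumr_ge0 // => i _.
by rewrite !mxE -expr2 sqr_ge0.
Qed.

(** The hessian of $f^Tf$ is $D^TD$, with $D$ the derivative of $f$ in the letters of its own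
    type. *)
Lemma psdmx_hessian_sqr (R : realType) (g n : nat) (b : bool) (f : ncpoly R g)
    (X H : 'I_g -> 'M[R]_n) :
  (forall w : fmonom (xletter g), w \in msupp f -> homword b (fmonom_val w)) ->
  psdmx (nclin (d2word (xval X) (xval H)) (ncadj f * f)).
Proof.
move=> fb; pose D := nclin (dword (xval X) (xval H) b) f.
suff -> : nclin (d2word (xval X) (xval H)) (ncadj f * f) = D^T *m D by exact:
  psdmx_trmxM.
rewrite {1}/ncadj [X in _ * X]ncmonE mulr_suml nclin_sum /D [in RHS]/nclin [X in
  X *m _]linear_sum /= mulmx_suml.
apply: eq_big_seq => u uf. rewrite mulr_sumr nclin_sum mulmx_sumr.
apply: eq_big_seq => w wf; rewrite ncmonM nclinU -/(trword _).
rewrite (@d2word_cat _ _ _ _ b) ?homword_trword ?negbK ?fb // dword_trword.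
by rewrite [(_ *: _)^T]linearZ /= -scalemxAl -scalemxAr scalerA.
Qed.

Lemma nclin_homword (R : realType) (g n : nat) (b : bool) (p : ncpoly R g)
    (X H : 'I_g -> 'M[R]_n) :
  (forall w : fmonom (xletter g), w \in msupp p -> homword b (fmonom_val w)) ->
  nclin (d2word (xval X) (xval H)) p = 0.
Proof.
move=> pb; rewrite /nclin big1_seq // => w /= wp.
by rewrite (d2word_homword _ _ (pb w wp)) scaler0.
Qed.

Lemma homword_ncadj (R : realType) (g : nat) (b : bool) (p : ncpoly R g) :
  (forall w : fmonom (xletter g), w \in msupp p -> homword b (fmonom_val w)) ->
  forall w : fmonom (xletter g), w \in msupp (ncadj p) -> homword (~~ b)
    (fmonom_val w).
Proof.
move=> pb -[w]; rewrite -mcoeff_neq0 mcoeff_ncadj mcoeff_neq0 => /pb /=.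
by rewrite homword_trword.
Qed.

(** * Assembly of the decomposition *)

Theorem theorem1p3 (R : realType) (g : nat) (p : ncpoly R g) (G : ncset R g)
    (psym : ncsymmetric p) (Gopen : ncopen G) (ppsh : ncpsh_on G p) :
  ncpsh_everywhere p /\
  exists (fs ks : seq (ncpoly R g)) (F : ncpoly R g),
    [/\ forall f : ncpoly R g, f \in fs -> ncanalytic f,
        forall k : ncpoly R g, k \in ks -> ncanalytic k,
        ncanalytic F &
        p = \sum_(f <- fs) ncadj f * f + \sum_(k <- ks) k * ncadj k
            + F + ncadj F].
Proof.
pose c w := mcoeff (FMonom w) p.
pose s := map (@fmonom_val _) (msupp p).
have s_uniq : uniq s by rewrite map_inj_uniq ?fset_uniq //; exact: val_inj.
have cE w : (c w != 0) = (w \in s).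
  by rewrite mcoeff_neq0 -[w]/(fmonom_val (FMonom w)) mem_map //; exact: val_inj.
have c_tr w : c (trword w) = c w by rewrite /c -mcoeff_ncadj psym.
pose d := \max_(w <- s) size w.
have s_le w : w \in s -> (size w <= d)%N by move=> ws;
  rewrite /d (leq_bigmax_seq w).
have p_le (w : fmonom (xletter g)) : w \in msupp p -> (size w <= d)%N.
  by move=> wp; apply: s_le; apply: map_f.
have [n [Y [v [rho [n_gt0 GY dual]]]]] := ncopen_dual_words d Gopen.
have form_ge0 b U : 0 <= \sum_(w <- s) c w * hess_form Y b U U [::] w.
  case: Gopen => _ Gsum _; have := ncpsh_hess_form_ge0 b U Gsum ppsh n_gt0 GY
    dual p_le.
  by rewrite big_map; congr (0 <= _); apply: eq_bigr => -[].
have s_run w : w \in s -> runword w.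
  move=> ws b z l m wE z0 zb lb.
  by apply: (ncpsh_run s_uniq cE c_tr s_le dual form_ge0 _ z0 zb lb); rewrite -wE.
have sos b := gram_sos p_le c_tr (fun x =>
  ncpsh_gram_ge0 x s_uniq cE s_le s_run n_gt0 (form_ge0 b)).
have [fs [fs_hom fsE]] := sos false; have [ks [ks_hom ksE]] := sos true.
(* The constant term is halved because the empty word occurs in both $F$ and $F^T$. *)
pose F : ncpoly R g := \sum_(w <- msupp p)
  (if homword false (fmonom_val w) then
     ncmon (if fmonom_val w == [::] then mcoeff w p / 2%:R else mcoeff w p)
       (fmonom_val w)
   else 0).
have FE k : mcoeff (FMonom k) F =
    if homword false k then (if k == [::] then c k / 2%:R else c k) else 0.
  rewrite /F raddf_sum /=.
  have [kp|kNp] := boolP (FMonom k \in msupp p).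
    rewrite (bigD1_seq _ kp (fset_uniq _)) /= big1 ?addr0 => [|w wN].
      by case: ifP => _; rewrite ?raddf0 // mcoeff_ncmon eqxx.
    by case: ifP => _; rewrite ?raddf0 // mcoeff_ncmon ifN.
  rewrite /c mcoeff_outdom // mul0r !if_same big1_seq // => -[w] /= wp.
  case: ifP => _; rewrite ?raddf0 // mcoeff_ncmon; case: eqP => // wE.
  by rewrite -wE wp in kNp.
have F_hom (w : fmonom (xletter g)) : w \in msupp F -> homword false (fmonom_val w).
  case: w => w; rewrite -mcoeff_neq0 FE /=.
  by case: ifP => // _; rewrite eqxx.
(* For [b] true the squares are $f^Tf$ with $f$ in the letters $x_j^T$ only, so the analytic $k_j$
   are the adjoints of the members of [ks]. *)
have pE : p = \sum_(f <- fs) ncadj f * f + \sum_(k <- map (@ncadj R g) ks) k *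
  ncadj k
            + F + ncadj F.
  have -> : \sum_(k <- map (@ncadj R g) ks) k * ncadj k = \sum_(k <- ks) ncadj k
    * k.
    by rewrite big_map; apply: eq_bigr => k _; rewrite ncadjK.
  apply/malgP => -[k]; rewrite !mcoeffD fsE ksE mcoeff_ncadj !FE homword_trword
    c_tr /=.
  rewrite -[mcoeff _ p]/(c k).
  have -> : (trword k == [::]) = (k == [::]) by rewrite -!size_eq0 size_trword.
  have [->|ck] := eqVneq (c k) 0; first by rewrite mul0r !if_same !addr0.
  rewrite cE in ck; have [->|k0] := eqVneq k [::];
    first by rewrite /= !add0r -splitr.
  (* The four cases are accounted for by $F$, $F^T$, $\sum f_j^Tf_j$ and $\sum k_jk_j^T$
     respectively. *)
  have [kh|kh|km|km] := runword_cases (s_run k ck).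
  - rewrite !(homword_mixed _ kh) kh !add0r.
    rewrite ifN ?addr0 //; apply: contraNN k0 => kh'.
    by rewrite -(homword_typed kh) homword_typedN.
  - rewrite !(homword_mixed _ kh) kh !add0r.
    rewrite ifN ?add0r //; apply: contraNN k0 => kh'.
    by rewrite -(homword_typed kh) homword_typedN.
  - rewrite km (mixedN km) !ifN ?addr0 //.
      by apply: contraL km => /homword_mixed ->.
    by apply: contraL km => /homword_mixed ->.
  - rewrite km (mixedN km) !ifN ?addr0 ?add0r //.
      by apply: contraL km => /homword_mixed ->.
    by apply: contraL km => /homword_mixed ->.
split; last first.
  exists fs, (map (@ncadj R g) ks), F; split => //.
  - by move=> f /fs_hom f_hom; apply/ncanalyticP.
  - by move=> _ /mapP[k /ks_hom k_hom ->]; apply/ncanalyticP;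
    exact: (homword_ncadj k_hom).
  - exact/ncanalyticP.
(* Positivity everywhere is read off the decomposition: $F$ and $F^T$ have zero hessian, and the
   squares have positive semidefinite ones. *)
move=> m X H _; rewrite xheval_nchessian pE big_map !nclinD.
rewrite (nclin_homword _ _ F_hom) (nclin_homword _ _ (homword_ncadj F_hom))
  !addr0 !nclin_sum.
apply: psdmxD; apply: psdmx_sum => f.
  by move=> /fs_hom; exact: psdmx_hessian_sqr.
by move=> /ks_hom; rewrite ncadjK; exact: psdmx_hessian_sqr.
Qed.
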